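(* Let $\{\lambda_j\}$ be an arbitrary (finite or countable) set of distinct positive numbers and let $\{\theta_j\}$ be a sequence of angles in $[0,\pi]$. If the set $\{\lambda_j\}$ is finite, then there exist potentials $q\in C^\infty[0,\infty)$ such that (1) for each $j$, the equation $(-D^2+q)u=\lambda_j u$ has a nontrivial solution $u\in L^2(\mathbb{R}^+)$ such that $\frac{u'(0)}{u(0)}=\tan\theta_j$; (2) $|q(x)|=\frac{O(1)}{|x|+1}$. If the set $\{\lambda_j\}$ is countable, then for any function $C(x)>0$ on $(0,\infty)$ with $\lim_{x\to\infty}C(x)=\infty$ there exist potentials $q\in C^\infty[0,\infty)$ such that (1) for each $j$, the equation $(-D^2+q)u=\lambda_j u$ has a nontrivial solution $u\in L^2(\mathbb{R}^+)$ such that $\frac{u'(0)}{u(0)}=\tan\theta_j$; (2) $|q(x)|\le\frac{C(x)}{|x|+1}$ for all $x>0$.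
   Context: $D=\frac{d}{dx}$, $\mathbb{R}^+=(0,\infty)$, and potentials are real-valued. The boundary condition $\frac{u'(0)}{u(0)}=\tan\theta$ with $\theta=\frac{\pi}{2}$ is understood as $u(0)=0$. *)

(* Defs.v *)
From HB Require Import structures.
From mathcomp Require Import all_boot all_order all_algebra.
From mathcomp Require Import all_classical all_reals all_analysis.

Set Implicit Arguments.
Unset Strict Implicit.
Unset Printing Implicit Defensive.

Import Order.TTheory GRing.Theory Num.Theory.
Import numFieldNormedType.Exports.

Local Open Scope classical_set_scope.
Local Open Scope ring_scope.

(* Functions on [0, +oo[ are represented by total functions R -> R whose values
   at negative points are irrelevant.  The library derivative is two-sided and
   would look at those values when x = 0, whereas this one is one-sided there. *)
Definition is_derive_hl (R : realType) (f : R -> R) (x l : R) : Prop :=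
  (fun y : R => (f y - f x) / (y - x)) @ within `[0, +oo[ (x^') --> l.

(* q is of class C^oo on [0, +oo[ : F n is the n-th derivative of q. *)
Definition smooth_hl (R : realType) (q : R -> R) : Prop :=
  exists F : nat -> R -> R,
    (forall x : R, 0 <= x -> F 0%N x = q x) /\
    (forall (n : nat) (x : R), 0 <= x -> is_derive_hl (F n) x (F n.+1 x)).

Definition is_L2_hl (R : realType) (u : R -> R) : Prop :=
  measurable_fun (`]0, +oo[ : set R) u /\
  (\int[@lebesgue_measure R]_(x in `]0%R, +oo[) ((`|u x| ^+ 2)%:E) < +oo)%E.

(* u0 and u0' are the values u(0) and u'(0). *)
Definition boundary_cond (R : realType) (theta u0 u0' : R) : Prop :=
  (theta = pi / 2 -> u0 = 0) /\
  (theta <> pi / 2 -> u0 <> 0 /\ u0' / u0 = tan theta).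

Definition L2_eigensolution (R : realType) (q : R -> R) (lambda theta : R) :
    Prop :=
  exists u u' u'' : R -> R,
    (forall x : R, 0 <= x -> is_derive_hl u x (u' x)) /\
    (forall x : R, 0 <= x -> is_derive_hl u' x (u'' x)) /\
    (forall x : R, 0 <= x -> - u'' x + q x * u x = lambda * u x) /\
    (exists x : R, 0 <= x /\ u x <> 0) /\
    is_L2_hl u /\
    boundary_cond theta (u 0) (u' 0).

(* Main.v *)
Require Import Defs.
From HB Require Import structures.
From mathcomp Require Import all_boot all_order all_algebra.
From mathcomp Require Import all_classical all_reals all_analysis.
From mathcomp Require Import measurable_realfun.
From mathcomp Require Import ring lra.

Import Order.TTheory GRing.Theory Num.Theory.
Import numFieldNormedType.Exports.

Local Open Scope classical_set_scope.
Local Open Scope ring_scope.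

(* Put k_i = sqrt lambda_i and let r_i, th_i be the Pruefer variables
   u_i = r_i sin th_i, u_i' = k_i r_i cos th_i, so that
   th_i' = k_i + O(q) and (ln r_i^2)' = (q / k_i) sin (2 th_i).
   If q = - sum_i k_i w_i sin (2 th_i) with weights w_i(t) ~ 8/t, then
   (ln r_j^2)' = - sum_i (k_i / k_j) w_i sin (2 th_i) sin (2 th_j).
   The term i = j has mean w_j / 2 and makes r_j^2 decay at least like 1/t^2; every other
   term oscillates and equals, up to O(w_i q) and O(w_i'), the derivative of a bounded
   quantity, because the k_i are distinct.

   This q solves a nonlinear system.  To construct it by linear equations only,
   sin (2 th_i(t)) is replaced by its forecast from time t - 1 under the free
   rotation th_i' = k_i, which costs an error O(q).  The potential on [0, n + 1] is
   then determined by its values on [0, n], and it is smooth because solutions of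
   linear equations with smooth coefficients are.

   The i-th weight is switched on at a point so far away that the constants of the
   first i eigenvalues are at most the fourth root of t there: all errors are then
   O(t^(-3/2)), hence integrable, and each compact interval sees only finitely many
   terms.  In the countable case the switching points also wait for C to be large. *)

(** * Derivatives and smooth functions *)

Section Derivatives.
Context {R : realType}.
Implicit Types (f g : R -> R) (x a b : R).

Lemma der_eq {f x} (a b : R) : is_derive x 1 f a -> a = b -> is_derive x 1 f b.
Proof. by move=> + <-. Qed.

Lemma der_cst (c x : R) : is_derive x 1 (fun=> c) (0 : R).
Proof. exact: is_derive_cst. Qed.

Lemma der_id x : is_derive x 1 (fun y : R => y) (1 : R).
Proof. exact: is_derive_id. Qed.

Lemma derD f g x a b : is_derive x 1 f a -> is_derive x 1 g b ->
  is_derive x 1 (fun y => f y + g y) (a + b).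
Proof. by move=> df dg; exact: is_deriveD. Qed.

Lemma derN f x a : is_derive x 1 f a -> is_derive x 1 (fun y => - f y) (- a).
Proof. by move=> df; exact: is_deriveN. Qed.

Lemma derB f g x a b : is_derive x 1 f a -> is_derive x 1 g b ->
  is_derive x 1 (fun y => f y - g y) (a - b).
Proof. by move=> df dg; exact: is_deriveB. Qed.

Lemma derM f g x a b : is_derive x 1 f a -> is_derive x 1 g b ->
  is_derive x 1 (fun y => f y * g y) (a * g x + f x * b).
Proof.
move=> df dg; apply: der_eq (is_deriveM df dg) _.
by rewrite /GRing.scale /= addrC [g x * a]mulrC.
Qed.

Lemma derMl (c : R) f x a : is_derive x 1 f a ->
  is_derive x 1 (fun y => c * f y) (c * a).
Proof.
by move=> df; apply: der_eq (derM _ _ _ _ _ (der_cst c x) df) _; rewrite mul0r add0r.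
Qed.

Lemma derV f x a : f x != 0 -> is_derive x 1 f a ->
  is_derive x 1 (fun y => (f y)^-1) (- a / f x ^+ 2).
Proof.
move=> f0 df; apply: der_eq (is_deriveV f0 df) _.
by rewrite /GRing.scale /= mulrC mulNr mulrN.
Qed.

Lemma der_comp f g x a b : is_derive (g x) 1 f a -> is_derive x 1 g b ->
  is_derive x 1 (fun y => f (g y)) (a * b).
Proof. by move=> df dg; exact: is_derive1_comp. Qed.

Lemma der_sum (n : nat) (f df : nat -> R -> R) x :
  (forall i, is_derive x 1 (f i) (df i x)) ->
  is_derive x 1 (fun y => \sum_(i < n) f i y) (\sum_(i < n) df i x).
Proof.
move=> dfi; elim: n => [|n IH].
  rewrite big_ord0; apply: (near_eq_is_derive _ (der_cst 0 x)).
  by near=> y; rewrite big_ord0.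
rewrite big_ord_recr /=.
apply: (near_eq_is_derive _ (derD _ _ _ _ _ IH (dfi n))).
by near=> y; rewrite big_ord_recr.
Unshelve. all: by end_near. Qed.

Lemma der_cont f x a : is_derive x 1 f a -> {for x, continuous f}.
Proof.
by move=> df; apply/differentiable_continuous/derivable1_diffP.
Qed.

Lemma der_unique f x a b : is_derive x 1 f a -> is_derive x 1 f b -> a = b.
Proof. by move=> [_ <-] [_ <-]. Qed.

Lemma der_near f g x a (y z : R) : y < x < z ->
  (forall t, y < t < z -> f t = g t) -> is_derive x 1 f a -> is_derive x 1 g a.
Proof.
move=> /andP[yx xz] fg; apply: near_eq_is_derive; near=> t; apply: fg.
by apply/andP; split; near: t; [exact: lt_nbhsr | exact: lt_nbhsl].
Unshelve. all: by end_near. Qed.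

Lemma mvt f (df : R -> R) a b : a <= b ->
  (forall x, a <= x <= b -> is_derive x 1 f (df x)) ->
  exists2 c, a <= c <= b & f b - f a = df c * (b - a).
Proof.
move=> ab dff.
have [||c cab E] := @MVT_segment R f df a b ab.
- move=> x; rewrite in_itv /= => /andP[ax xb]; apply: dff.
  by rewrite !ltW.
- apply/continuous_in_subspaceT => x; rewrite inE /= in_itv /= => xab.
  exact: der_cont (dff x xab).
by exists c => //; move: cab; rewrite in_itv.
Qed.

Lemma der_le0 f (df : R -> R) a b : a <= b ->
  (forall x, a <= x <= b -> is_derive x 1 f (df x)) ->
  (forall x, a <= x <= b -> df x <= 0) -> f b <= f a.
Proof.
move=> ab dff df0; have [c cab E] := mvt f df a b ab dff.
by rewrite -subr_le0 E mulr_le0_ge0 ?df0 // subr_ge0.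
Qed.

Lemma der_norm_le f g (df dg : R -> R) a b : a <= b ->
  (forall x, a <= x <= b -> is_derive x 1 f (df x)) ->
  (forall x, a <= x <= b -> is_derive x 1 g (dg x)) ->
  (forall x, a <= x <= b -> `|df x| <= dg x) ->
  `|f b - f a| <= g b - g a.
Proof.
move=> ab dff dgg le; rewrite ler_norml.
have h1 : f b - g b <= f a - g a.
  apply: (der_le0 (fun x => f x - g x) (fun x => df x - dg x)) => // x xab.
    by apply: derB; auto.
  by rewrite subr_le0 (le_trans (ler_norm _)) ?le.
have h2 : - f b - g b <= - f a - g a.
  apply: (der_le0 (fun x => - f x - g x) (fun x => - df x - dg x)) => // x xab.
    by apply: derB; [apply: derN|]; auto.
  by rewrite subr_le0 (le_trans (ler_norm _)) ?normrN ?le.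
by apply/andP; split; lra.
Qed.

(** Integration from 0 only handles [x > 0]. Since [f] vanishes for [x <= 1], so does the integral,
    and for [x <= 0] the derivative is that of the zero function; no backward integral arises. *)
Lemma antiderivative f : continuous f -> (forall x, x <= 1 -> f x = 0) ->
  exists F : R -> R, (forall x, is_derive x 1 F (f x)) /\
                     (forall x, x <= 1 -> F x = 0).
Proof.
move=> cf f0; pose F x := (\int[lebesgue_measure]_(t in [set` `[(0:R), x]]) f t)%R.
have F0 x : x <= 1 -> F x = 0.
  move=> x1; rewrite /F (eq_Rintegral _ (g := fun=> 0)).
    by rewrite Rintegral_cst // mul0r.
  by move=> t; rewrite inE /= in_itv /= => /andP[_ tx]; apply: f0; exact: le_trans tx x1.
exists F; split => // x; have [x0|x0] := ltP 0 x.
  have x1 : x < x + 1 by lra.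
  have [] := @continuous_FTC1_closed R f 0 x (x + 1) x1.
  - apply: continuous_compact_integrable; first exact: segment_compact.
    by apply: continuous_subspaceT.
  - exact: x0.
  - exact: cf.
  by move=> D1 D2; apply: DeriveDef => //; rewrite -derive1E D2.
rewrite f0; last lra.
apply: (der_near (fun=> 0) F x 0 (x - 1) 1); first by lra.
by move=> t /andP[_ t1]; rewrite F0 // ltW.
Qed.

End Derivatives.

Arguments derD {R f g x a b}.
Arguments derN {R f x a}.
Arguments derB {R f g x a b}.
Arguments derM {R f g x a b}.
Arguments derMl {R} c {f x a}.
Arguments derV {R f x a}.
Arguments der_comp {R} f {g x a b}.

Section Smooth.
Context {R : realType}.
Implicit Types (f g : R -> R) (n : nat) (x t : R).

(** Regularity is stated on the whole line with two-sided derivatives. The potentials constructed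
    below vanish for [x <= 1], so they extend smoothly to negative points, and [der_hl] passes to
    one-sided derivatives only at the end. *)
Fixpoint Cn n f : Prop :=
  if n is m.+1 then exists g : R -> R, (forall x : R, is_derive x 1 f (g x)) /\ Cn m g
  else continuous f.

Definition smooth f := forall n, Cn n f.

Lemma Cn_continuous n f : Cn n f -> continuous f.
Proof. by case: n => // n [g [fg _]] x; exact: der_cont (fg x). Qed.

Lemma CnW n f : Cn n.+1 f -> Cn n f.
Proof.
elim: n f => [|n IH] f; first exact: Cn_continuous.
by move=> [g [fg /IH Cg]]; exists g.
Qed.

Lemma Cn_ext n f g : f =1 g -> Cn n f -> Cn n g.
Proof. by move=> /funext ->. Qed.

Lemma Cn_cst n (c : R) : Cn n (fun=> c).
Proof.
elim: n c => [|n IH] c; first exact: cst_continuous.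
by exists (fun=> 0); split => // x; exact: der_cst.
Qed.

Lemma Cn_id n : Cn n (fun x : R => x).
Proof.
case: n => [|n]; first by move=> x; exact: cvg_id.
by exists (fun=> 1); split => [x|]; [exact: der_id | exact: Cn_cst].
Qed.

Lemma CnD n f g : Cn n f -> Cn n g -> Cn n (fun x => f x + g x).
Proof.
elim: n f g => [|n IH] f g /=.
  by move=> cf cg x; apply: cvgD; [exact: cf | exact: cg].
move=> [f' [ff' Cf]] [g' [gg' Cg]]; exists (fun x => f' x + g' x).
by split=> [x|]; [exact: derD | exact: IH].
Qed.

Lemma CnM n f g : Cn n f -> Cn n g -> Cn n (fun x => f x * g x).
Proof.
elim: n f g => [|n IH] f g.
  by move=> cf cg x; apply: cvgM; [exact: cf | exact: cg].
move=> Cf Cg; move: (Cf) (Cg) => [f' [ff' Cf']] [g' [gg' Cg']].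
exists (fun x => f' x * g x + f x * g' x); split=> [x|]; first exact: derM.
by apply: CnD; apply: IH => //; exact: CnW.
Qed.

Lemma CnV n f : (forall x, f x != 0) -> Cn n f -> Cn n (fun x => (f x)^-1).
Proof.
move=> f0; elim: n => [|n IH].
  by move=> cf x; apply: cvgV; [exact: f0 | exact: cf].
move=> Cf; have [f' [ff' Cf']] := Cf; have CV := IH (CnW _ _ Cf).
exists (fun x => (-1 * f' x) * ((f x)^-1 * (f x)^-1)); split=> [x|].
  apply: der_eq (derV (f0 x) (ff' x)) _.
  by rewrite mulN1r expr2 invfM.
apply: CnM; last exact: CnM.
by apply: CnM => //; exact: Cn_cst.
Qed.

Lemma Cn_affine n f (c d : R) : Cn n f -> Cn n (fun x => f (c * x + d)).
Proof.
have dl (x : R) : is_derive x 1 (fun y => c * y + d) c.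
  apply: der_eq (derD (derMl c (der_id x)) (der_cst d x)) _.
  by rewrite mulr1 addr0.
elim: n f => [|n IH] f.
  move=> cf x; apply: (@continuous_comp _ _ _ (fun y => c * y + d) f).
    exact: der_cont (dl x).
  exact: cf.
move=> [f' [ff' Cf']]; exists (fun x => f' (c * x + d) * c); split=> [x|].
  exact: der_comp.
by apply: CnM; [exact: IH | exact: Cn_cst].
Qed.

Lemma Cn_sum n N (f : nat -> R -> R) : (forall i, Cn n (f i)) ->
  Cn n (fun x => \sum_(i < N) f i x).
Proof.
move=> Cf; elim: N => [|N IH].
  by apply: Cn_ext (Cn_cst n 0) => x; rewrite big_ord0.
by apply: Cn_ext (CnD _ _ _ IH (Cf N)) => x; rewrite big_ord_recr.
Qed.

Lemma continuous_local f :
  (forall m : nat, exists2 g, continuous g & forall x, x <= m%:R -> f x = g x) ->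
  continuous f.
Proof.
move=> loc x; pose m := Num.bound `|x|.
have xm : x < m%:R by rewrite (le_lt_trans (ler_norm x)) // archi_boundP.
have [g cg fg] := loc m; rewrite /continuous_at fg; last exact: ltW.
apply: cvg_trans (cg x); apply: near_eq_cvg; near=> y.
by rewrite fg //; apply: ltW; near: y; exact: lt_nbhsl.
Unshelve. all: by end_near. Qed.

(** Meant for a limit of functions that stabilise on every half-line [x <= m]. The derivatives of
    the local models agree where both are valid, by uniqueness, and so patch together. *)
Lemma Cn_local n f :
  (forall m : nat, exists2 g, Cn n g & forall x, x <= m%:R -> f x = g x) ->
  Cn n f.
Proof.
elim: n f => [|n IH] f; first exact: continuous_local.
move=> loc.
have /choice [g' H] (m : nat) : exists g' : R -> R, Cn n g' /\
    forall x, x < m%:R -> is_derive x 1 f (g' x).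
  have [g [g' [dg Cg']] fg] := loc m; exists g'; split=> // x xm.
  apply: (der_near g f x _ (x - 1) m%:R) => //; first by lra.
  by move=> t /andP[_ tm]; rewrite fg // ltW.
have df x (m : nat) : x < m%:R -> is_derive x 1 f (g' m x) by exact: (H m).2.
exists (fun x => g' (Num.bound `|x|) x); split=> [x|].
  by apply: df; rewrite (le_lt_trans (ler_norm x)) // archi_boundP.
(* The derivative of [f] is matched with [g' m] only for [x < m], so the closed half-line [x <= m]
   needs the next model. *)
apply: IH => m; exists (g' m.+1); first exact: (H m.+1).1.
move=> x xm; apply: (der_unique f x); apply: df.
  by rewrite (le_lt_trans (ler_norm x)) // archi_boundP.
by rewrite (le_lt_trans xm) // ltr_nat.
Qed.

(** The derivative witnessed by [Cn n] may a priori depend on [n]; uniqueness identifies all the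
    witnesses with [derive1 f]. *)
Lemma smooth_derive f : smooth f ->
  (forall x, is_derive x 1 f (derive1 f x)) /\ smooth (derive1 f).
Proof.
move=> sf; have df n : exists2 g, (forall x, is_derive x 1 f (g x)) & Cn n g.
  by have [g []] := sf n.+1; exists g.
have E g : (forall x, is_derive x 1 f (g x)) -> g =1 (derive1 f).
  by move=> dg x; rewrite derive1E; have [_ ->] := dg x.
split=> [x|n]; have [g dg Cg] := df 0%N.
  by rewrite -E.
by have [h dh Ch] := df n; apply: Cn_ext Ch; exact: E.
Qed.

Lemma der_hl f x l : is_derive x 1 f l -> is_derive_hl f x l.
Proof.
move=> /is_derive1_caratheodory [g [fE cg <-]].
rewrite /is_derive_hl; apply: cvg_within_filter.
apply: cvg_trans (cvg_within_filter _ cg); apply: near_eq_cvg.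
near=> y; rewrite fE mulfK // subr_eq0.
by near: y; exact: nbhs_dnbhs_neq.
Unshelve. all: by end_near. Qed.

Lemma smooth_smooth_hl f : smooth f -> smooth_hl f.
Proof.
move=> sf; exists (fun n => (derive1n n f)); split => // n x _; apply: der_hl.
have sn : smooth (derive1n n f).
  by elim: n => // n IH; rewrite derive1nS; exact: (smooth_derive _ IH).2.
by rewrite derive1nS; exact: (smooth_derive _ sn).1.
Qed.

End Smooth.

(** * The switching weight *)

Section Cutoff.
Context {R : realType}.
Implicit Types (f g : R -> R) (n m : nat) (x y t : R).

Lemma lipschitz_continuous_at f x (C d : R) : 0 < d ->
  (forall y, `|x - y| < d -> `|f x - f y| <= C * `|x - y|) -> {for x, continuous f}.
Proof.
move=> d0 lip; apply/cvgrPdist_le => e e0; near=> y.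
have D : 0 < `|C| + 1 by rewrite ltr_wpDl.
have xyd : `|x - y| < d by near: y; exact: cvgr_dist_lt.
have xye : `|x - y| <= e / (`|C| + 1).
  by near: y; apply: cvgr_dist_le; rewrite ?divr_gt0.
apply: le_trans (lip y xyd) _.
apply: (@le_trans _ _ ((`|C| + 1) * `|x - y|)).
  by rewrite ler_wpM2r // (le_trans (ler_norm C)) // lerDl.
by rewrite mulrC -ler_pdivlMr.
Unshelve. all: by end_near. Qed.

(** Write [y ^ m = m ^ m * (y / m) ^ m] and use [y / m <= expR (y / m)]. For [m = 0] the constant is
    [0 ^ 0 = 1]. *)
Lemma pow_le_expR m : exists2 C : R, 0 <= C & forall y, 0 <= y -> y ^+ m <= C * expR y.
Proof.
exists (m%:R ^+ m) => [|y y0]; first exact: exprn_ge0.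
case: m => [|m]; first by rewrite !expr0 mul1r -expR0 ler_expR.
have M0 : m.+1%:R != 0 :> R by rewrite pnatr_eq0.
have -> : y = m.+1%:R * (y / m.+1%:R) by field.
rewrite expRM_natl exprMn ler_wpM2l ?exprn_ge0 // lerXn2r ?nnegrE ?expR_ge0 ?divr_ge0 //.
by apply: le_trans (expR_ge1Dx _); rewrite lerDr.
Qed.

(** For [m = 0] this is the classical flat function [exp (- 1 / x)]. The extra powers of [1 / x]
    make the family closed under differentiation, up to linear combinations. *)
Definition flat m x : R := if 0 < x then (x^-1) ^+ m * expR (- x^-1) else 0.

Lemma flatS m x : flat m x = flat m.+1 x * x.
Proof.
rewrite /flat; case: ltP => [x0|_]; last by rewrite mul0r.
rewrite exprSr -!mulrA [expR _ * x]mulrC mulrA mulrA -[_ * x^-1 * x]mulrA.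
by rewrite mulVf ?gt_eqF // mulr1.
Qed.

Lemma flat_der m x :
  is_derive x 1 (flat m) (- m%:R * flat m.+1 x + flat m.+2 x).
Proof.
have [x0|x0|<-] := ltgtP 0 x.
- have dV : is_derive x 1 (fun y : R => y^-1) (- x^-1 ^+ 2).
    apply: der_eq (derV _ (der_id x)) _; first by rewrite gt_eqF.
    by rewrite mulN1r exprVn.
  have dVX k : is_derive x 1 (fun y : R => y^-1 ^+ k) (- k%:R * x^-1 ^+ k.+1).
    elim: k => [|k IH].
      by apply: der_eq (der_cst 1 x) _; rewrite oppr0 mul0r.
    have -> : (fun y : R => y^-1 ^+ k.+1) = (fun y => y^-1 * y^-1 ^+ k).
      by apply/funext => y; rewrite exprS.
    by apply: der_eq (derM dV IH) _; rewrite -natr1 !exprS; ring.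
  apply: (der_near (fun y => y^-1 ^+ m * expR (- y^-1)) _ x _ 0 (x + 1)).
  + by lra.
  + by move=> t /andP[t0 _]; rewrite /flat t0.
  apply: der_eq (derM (dVX m) (der_comp _ (is_derive_expR _) (derN dV))) _.
  by rewrite /flat x0 !exprS; ring.
- apply: (der_near (fun=> 0) _ x _ (x - 1) 0); first by lra.
    by move=> t /andP[_ t0]; rewrite /flat ltNge (ltW t0).
  by apply: der_eq (der_cst 0 x) _; rewrite /flat ltNge (ltW x0) /= mulr0 addr0.
(* At 0 the difference quotient is [flat m.+1], by [flatS]. It is continuous there because the
   exponential dominates [m.+2] powers of [1 / y], which gives the bound [C * |y|]. *)
have z k : flat k 0 = 0 by rewrite /flat ltxx.
rewrite !z mulr0 addr0; apply/is_derive1_caratheodory.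
exists (flat m.+1); split=> [y||//]; first by rewrite z !subr0 -flatS.
have [C C0 HC] := pow_le_expR m.+2.
apply: (lipschitz_continuous_at _ _ C 1) => // y _.
rewrite z !sub0r !normrN /flat; case: ltP => [y0|_]; last first.
  by rewrite normr0 mulr_ge0.
have yV : 0 <= y^-1 by rewrite invr_ge0 ltW.
rewrite !ger0_norm ?(ltW y0) //; last by rewrite mulr_ge0 ?exprn_ge0 ?expR_ge0.
have := HC _ yV; rewrite -ler_pdivrMr ?expR_gt0 // -expRN.
rewrite exprSr mulrAC -ler_pdivlMr ?invr_gt0 //; by rewrite invrK.
Qed.

Lemma flat_Cn n m : Cn n (flat m).
Proof.
elim: n m => [|n IH] m; first by move=> x; exact: der_cont (flat_der m x).
exists (fun x => - m%:R * flat m.+1 x + flat m.+2 x); split=> [x|].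
  exact: flat_der.
by apply: CnD => //; apply: CnM => //; exact: Cn_cst.
Qed.

(* [x] is the point where the weight is switched on. *)
Definition weight x t : R := 8 * (t / (1 + t ^+ 2)) * flat 0 (x^-1 * t + -1).

Definition dweight x t : R :=
  8 * ((1 - t ^+ 2) / (1 + t ^+ 2) ^+ 2) * flat 0 (x^-1 * t + -1) +
  8 * (t / (1 + t ^+ 2)) * (flat 2 (x^-1 * t + -1) * x^-1).

Lemma oneD_gt0 t : 0 < 1 + t ^+ 2.
Proof. by rewrite ltr_pwDl // sqr_ge0. Qed.

Lemma weight_Cn n x : Cn n (weight x).
Proof.
apply: CnM; last first.
  exact: (Cn_affine _ _ _ _ (flat_Cn n 0)).
apply: CnM; first exact: Cn_cst.
apply: CnM; first exact: Cn_id.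
apply: CnV => [t|]; first by rewrite gt_eqF // oneD_gt0.
apply: CnD; first exact: Cn_cst.
by apply: (CnM _ _ _ (Cn_id n) (Cn_id n)).
Qed.

Lemma weight_der x t : is_derive t 1 (weight x) (dweight x t).
Proof.
have d2 : is_derive t 1 (fun t : R => 1 + t ^+ 2) (t + t).
  apply: der_eq (derD (der_cst 1 t) (derM (der_id t) (der_id t))) _.
  by ring.
have n0 := oneD_gt0 t; have n0' : 1 + t ^+ 2 != 0 by rewrite gt_eqF.
have da : is_derive t 1 (fun t : R => x^-1 * t + -1) x^-1.
  apply: der_eq (derD (derMl x^-1 (der_id t)) (der_cst (-1) t)) _.
  by ring.
have := derM (derMl 8 (derM (der_id t)
  (derV (f := fun t => 1 + t ^+ 2) n0' d2))) (der_comp (flat 0) (flat_der 0 _) da).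
move=> /der_eq; apply.
rewrite /dweight oppr0 mul0r add0r; congr (_ * _ + _).
by field.
Qed.

Lemma flat_ge0 m x : 0 <= flat m x.
Proof.
rewrite /flat; case: ltP => // x0.
by rewrite mulr_ge0 ?expR_ge0 // exprn_ge0 // invr_ge0 ltW.
Qed.

Lemma flat0_le1 x : flat 0 x <= 1.
Proof.
rewrite /flat; case: ltP => // x0; rewrite expr0 mul1r -expR0 ler_expR.
by rewrite oppr_le0 invr_ge0 ltW.
Qed.

(** With [y = 1 / x] this is [(1 + y) ^ 2 <= 4 * expR y], which follows by squaring
    [1 + y / 2 <= expR (y / 2)]. The bound is in terms of [1 + x] because at [x = t / X - 1] this is
    [t / X], so the switching point cancels in [dweight_le]. *)
Lemma flat2_le x : 0 < x -> flat 2 x <= 4 / (1 + x) ^+ 2.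
Proof.
move=> x0; rewrite /flat x0; have y0 : 0 < x^-1 by rewrite invr_gt0.
have -> : 1 + x = (1 + x^-1) / x^-1 by field; lra.
move: (x^-1) y0 => y y0; rewrite expr_div_n invf_div.
have h : (1 + y) ^+ 2 <= 4 * expR y.
  have h1 : 1 + y / 2 <= expR (y / 2) by exact: expR_ge1Dx.
  have -> : expR y = expR (y / 2) ^+ 2 by rewrite -expRM_natl; congr expR; field.
  nra.
have -> : 4 * (y ^+ 2 / (1 + y) ^+ 2) = y ^+ 2 * (4 / (1 + y) ^+ 2) by ring.
rewrite ler_wpM2l ?sqr_ge0 // ler_pdivlMr ?exprn_gt0 //; last by lra.
by rewrite expRN mulrC ler_pdivrMr ?expR_gt0.
Qed.

Lemma weight_off x t : 0 < x -> t <= x -> weight x t = 0 /\ dweight x t = 0.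
Proof.
move=> x0 tx; have F m : flat m (x^-1 * t + -1) = 0.
  rewrite /flat ltNge; suff -> : x^-1 * t + -1 <= 0 by [].
  by rewrite subr_le0 mulrC ler_pdivrMr // mul1r.
by rewrite /weight /dweight !F !mul0r !mulr0 addr0.
Qed.

Lemma weight_ge0 x t : 0 <= t -> 0 <= weight x t.
Proof.
by move=> t0; rewrite /weight !mulr_ge0 ?flat_ge0 // invr_ge0 ltW // oneD_gt0.
Qed.

Lemma weight_le x t : 0 < t -> weight x t <= 8 / t.
Proof.
move=> t0; rewrite /weight; apply: (@le_trans _ _ (8 * (t / (1 + t ^+ 2)))).
  rewrite ler_piMr ?flat0_le1 // !mulr_ge0 ?(ltW t0) // invr_ge0 ltW //.
  exact: oneD_gt0.
rewrite ler_wpM2l // ler_pdivrMr ?oneD_gt0 // mulrC ler_pdivlMr //.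
by rewrite expr2; lra.
Qed.

(** From [3 * x] on, the cutoff is at least [exp (- 1 / 2) >= 1 / 2]. The lower bound is twice the
    derivative of [ln (1 + t ^ 2)], so that half the weight pays for a factor [1 + t ^ 2] in
    [decay]. *)
Lemma weight_lb x t : 0 < x -> 3 * x <= t -> 4 * (t / (1 + t ^+ 2)) <= weight x t.
Proof.
move=> x0 xt; have t0 : 0 < t by lra.
have arg : 2 <= x^-1 * t + -1.
  by rewrite -lerBlDr mulrC ler_pdivlMr //; lra.
have : 2^-1 <= flat 0 (x^-1 * t + -1).
  rewrite /flat ifT ?expr0 ?mul1r; last by lra.
  apply: le_trans (expR_ge1Dx _).
  have : (x^-1 * t + -1)^-1 <= 2^-1 by rewrite lef_pV2 // posrE; lra.
  by lra.
move=> h; have : 0 <= t / (1 + t ^+ 2).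
  by rewrite divr_ge0 ?ltW // oneD_gt0.
rewrite /weight; move: (t / _) (flat _ _) h => a b h a0; nra.
Qed.

(** The rational factor contributes [8 / t ^ 2] and the cutoff [32 / t ^ 2]. The bound is uniform in
    the switching point, since [x / t <= 1] absorbs the slope [1 / x] of the cutoff. *)
Lemma dweight_le x t : 0 < x -> x < t -> `|dweight x t| <= 40 / t ^+ 2.
Proof.
move=> x0 xt; have t0 : 0 < t by lra.
have arg : 0 < x^-1 * t + -1 by rewrite subr_gt0 mulrC ltr_pdivlMr // mul1r.
have F2 : flat 2 (x^-1 * t + -1) * x^-1 <= 4 / t.
  apply: (@le_trans _ _ (4 / (1 + (x^-1 * t + -1)) ^+ 2 * x^-1)).
    by rewrite ler_wpM2r ?invr_ge0 ?(ltW x0) // flat2_le.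
  have -> : 4 / (1 + (x^-1 * t + -1)) ^+ 2 * x^-1 = (x / t) * (4 / t).
    by field; lra.
  rewrite ler_piMl ?divr_ge0 ?(ltW t0) // ler_pdivrMr // mul1r; exact: ltW.
have F0 := flat0_le1 (x^-1 * t + -1); have G0 := flat_ge0 0 (x^-1 * t + -1).
have G2 : 0 <= flat 2 (x^-1 * t + -1) * x^-1.
  by rewrite mulr_ge0 ?flat_ge0 // invr_ge0 ltW.
rewrite /dweight; move: (flat 0 _) (flat 2 _ * _) F0 G0 F2 G2 => a b a1 a0 b1 b0.
have D := oneD_gt0 t; have t20 : 0 < t ^+ 2 by rewrite exprn_gt0.
have A : `|8 * ((1 - t ^+ 2) / (1 + t ^+ 2) ^+ 2) * a| <= 8 / t ^+ 2.
  rewrite !normrM normfV (ger0_norm a0) (ger0_norm (sqr_ge0 _)) gtr0_norm //.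
  apply: (@le_trans _ _ (8 * (`|1 - t ^+ 2| / (1 + t ^+ 2) ^+ 2))).
    by rewrite ler_piMr // mulr_ge0 // divr_ge0 // sqr_ge0.
  rewrite ler_wpM2l // ler_pdivrMr ?exprn_gt0 // mulrC ler_pdivlMr //.
  apply: (@le_trans _ _ ((1 + t ^+ 2) * (1 + t ^+ 2))); last by rewrite expr2.
  apply: ler_pM => //; first by exact: ltW.
    rewrite ler_norml; apply/andP; split; lra.
  by lra.
have B : `|8 * (t / (1 + t ^+ 2)) * b| <= 32 / t ^+ 2.
  have h : t / (1 + t ^+ 2) <= t^-1.
    by rewrite ler_pdivrMr // mulrC ler_pdivlMr // expr2; lra.
  have h0 : 0 <= t / (1 + t ^+ 2) by rewrite divr_ge0 // ltW.
  have n80 : 0 <= 8 * (t / (1 + t ^+ 2)) by apply: mulr_ge0.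
  rewrite ger0_norm; last exact: mulr_ge0.
  have -> : 32 / t ^+ 2 = 8 * t^-1 * (4 / t) by field; lra.
  by apply: ler_pM => //; exact: ler_wpM2l.
apply: (le_trans (ler_normD _ _)); apply: (le_trans (lerD A B)).
have -> : 40 / t ^+ 2 = 8 / t ^+ 2 + 32 / t ^+ 2 by rewrite -mulrDl; congr (_ / _); lra.
by [].
Qed.

End Cutoff.

(** * Linear second-order equations *)

Section GeometricLimits.
Context {R : realType}.
Implicit Types (u : nat -> R) (l B : R).

(** The intervals of radius [2 * B / 2 ^ m] around [u m] are nested; the supremum of their left
    endpoints lies in all of them. *)
Lemma geometric_limit u B : 0 <= B ->
  (forall m, `|u m.+1 - u m| <= B / 2 ^+ m) ->
  exists l, forall m, `|u m - l| <= 2 * B / 2 ^+ m.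
Proof.
move=> B0 du; pose a m := u m - 2 * B / 2 ^+ m; pose b m := u m + 2 * B / 2 ^+ m.
have E m : 2 * B / 2 ^+ m.+1 = B / 2 ^+ m :> R.
  by rewrite exprS invfM mulrACA mulfV // mul1r.
have E2 m : 2 * B / 2 ^+ m = B / 2 ^+ m + B / 2 ^+ m :> R by rewrite -mulrA -mulr2n mulr_natl.
have a_nd : {homo a : m n / (m <= n)%N >-> m <= n}.
  apply: homo_leq => [//|y x z|m]; first exact: le_trans.
  rewrite /a E E2; have := du m; rewrite ler_norml => /andP[]; move: (B / _) => c; lra.
have b_ni : {homo b : m n / (m <= n)%N >-> n <= m}.
  apply: (homo_leq (r := fun x y => y <= x)) => [//|y x z yx zy|m]; first exact: le_trans zy yx.
  rewrite /b E E2; have := du m; rewrite ler_norml => /andP[]; move: (B / _) => c; lra.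
have ab m n : a m <= b n.
  apply: (le_trans (a_nd m (maxn m n) (leq_maxl _ _))).
  apply: le_trans (b_ni n (maxn m n) (leq_maxr _ _)).
  rewrite /a /b; have : 0 <= 2 * B / 2 ^+ maxn m n by rewrite divr_ge0 ?mulr_ge0 ?exprn_ge0.
  by move: (_ / _) => c; lra.
exists (sup (range a)) => m.
have ubm n : ubound (range a) (b n) by move=> _ [k _ <-].
have h1 : a m <= sup (range a).
  by apply: ub_le_sup; [exists (b 0%N); exact: ubm | exists m].
have h2 : sup (range a) <= b m.
  by apply: ge_sup; [exists (a m), m | exact: ubm].
rewrite ler_norml; move: h1 h2; rewrite /a /b; move: (_ / _) (sup _) => c s; lra.
Qed.

Lemma le_geometric (x B : R) : (forall m, x <= B / 2 ^+ m) -> x <= 0.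
Proof.
move=> h; rewrite leNgt; apply/negP => x0.
have B0 : 0 < B by have := h 0%N; rewrite expr0 divr1; exact: lt_le_trans.
pose n := Num.bound (B / x).
have hn : B / x < n%:R by apply: archi_boundP; rewrite divr_ge0 // ltW.
have n2 : n%:R <= 2 ^+ n :> R by rewrite -natrX ler_nat ltnW // ltn_expl.
have := h n; rewrite ler_pdivlMr ?exprn_gt0 // leNgt => /negP; apply.
by move: hn; rewrite ltr_pdivrMr // => hn; nra.
Qed.

Lemma geometric_limit_unique u l l' B B' :
  (forall m, `|u m - l| <= B / 2 ^+ m) -> (forall m, `|u m - l'| <= B' / 2 ^+ m) ->
  l = l'.
Proof.
move=> h h'; apply/eqP; rewrite -subr_eq0 -normr_le0.
apply: (@le_geometric _ (B + B')) => m.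
have -> : l - l' = (u m - l') - (u m - l) by ring.
by apply: (le_trans (ler_normB _ _)); rewrite mulrDl addrC lerD.
Qed.

End GeometricLimits.

Section LinearODE.
Context {R : realType}.
Implicit Types (f g p q h : R -> R) (x y T K : R).

Lemma continuous_bounded f T : continuous f ->
  exists2 K, 0 < K & forall x, 0 <= x <= T -> `|f x| <= K.
Proof.
move=> cf; have [T0|T0] := leP 0 T; last by exists 1 => // x; lra.
have cn : {within `[0, T], continuous (fun x => `|f x|)}.
  apply: continuous_subspaceT => x; apply: cvg_norm; exact: cf.
have [c _ Hc] := EVT_max T0 cn; exists (`|f c| + 1) => [|x x0T].
  by rewrite ltr_wpDl.
by apply: (@le_trans _ _ `|f c|); [apply: Hc; rewrite in_itv | rewrite lerDl].
Qed.

Lemma lin_bound f (df : R -> R) T K : f 0 = 0 -> 0 <= K ->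
  (forall x, 0 <= x <= T -> is_derive x 1 f (df x)) ->
  (forall x, 0 <= x <= T -> `|df x| <= K) ->
  forall x, 0 <= x <= T -> `|f x| <= K * T.
Proof.
move=> f0 K0 dff dfK x /andP[x0 xT].
have := der_norm_le f (fun y => K * y) df (fun=> K) 0 x x0.
rewrite f0 mulr0 !subr0 => H; apply: (le_trans (H _ _ _)).
- by move=> y /andP[y0 yx]; apply: dff; rewrite y0 (le_trans yx).
- by move=> y _; apply: der_eq (derMl K (der_id y)) _; rewrite mulr1.
- by move=> y /andP[y0 yx]; apply: dfK; rewrite y0 (le_trans yx).
- by rewrite ler_wpM2l.
Qed.

(** One integration gains a factor [1 / L] in the exponentially weighted norm. A Picard step
    integrates twice. *)
Lemma exp_bound f (df : R -> R) (T A L : R) : f 0 = 0 -> 0 <= A -> 0 < L ->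
  (forall x, 0 <= x <= T -> is_derive x 1 f (df x)) ->
  (forall x, 0 <= x <= T -> `|df x| <= A * expR (L * x)) ->
  forall x, 0 <= x <= T -> `|f x| <= A / L * expR (L * x).
Proof.
move=> f0 A0 L0 dff dfA x /andP[x0 xT].
have := der_norm_le f (fun y => A / L * expR (L * y)) df
  (fun y => A * expR (L * y)) 0 x x0.
rewrite f0 !subr0 => H; apply: (le_trans (H _ _ _)).
- by move=> y /andP[y0 yx]; apply: dff; rewrite y0 (le_trans yx).
- move=> y _; apply: der_eq (derMl _ (der_comp expR (is_derive_expR _)
    (derMl L (der_id y)))) _.
  by field; rewrite gt_eqF.
- by move=> y /andP[y0 yx]; apply: dfA; rewrite y0 (le_trans yx).
- by rewrite lerBlDr lerDl mulr_ge0 ?expR_ge0 // divr_ge0 // ltW.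
Qed.

Definition vanishes f := forall x, x <= 1 -> f x = 0.

(* Picard iteration; since every iterate vanishes on [x <= 1], only forward
   estimates are needed, in the norm weighted by [expR (L * x)]. *)
Lemma picard p h : continuous p -> continuous h -> vanishes h ->
  exists z z1 : R -> R,
    [/\ forall x, is_derive x 1 z (z1 x),
        forall x, is_derive x 1 z1 (p x * z x + h x), vanishes z & vanishes z1].
Proof.
move=> cp ch h0.
(* [step z] holds the first and the second antiderivative of [p * z + h]; the pair [(z, z)] is a
   dummy value for [z] outside the hypotheses. *)
have /choice [step Hstep] (z : R -> R) : exists F : (R -> R) * (R -> R),
    continuous z -> vanishes z ->
    [/\ forall x, is_derive x 1 F.1 (p x * z x + h x),
        forall x, is_derive x 1 F.2 (F.1 x), vanishes F.1 & vanishes F.2].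
  have [[cz z0]|] := pselect (continuous z /\ vanishes z); last first.
    by move=> nz; exists (z, z) => cz z0; case: nz.
  have [|x x1|F1 [dF1 F10]] := antiderivative (fun x => p x * z x + h x).
  - by move=> x; apply: cvgD; [apply: cvgM; [exact: cp | exact: cz] | exact: ch].
  - by rewrite z0 // h0 // mulr0 addr0.
  have [x|//|F2 [dF2 F20]] := antiderivative F1; first exact: der_cont (dF1 x).
  by exists (F1, F2).
pose z := fix z m := if m is m'.+1 then (step (z m')).2 else fun _ : R => 0 : R.
pose z1 m := (step (z m)).1.
have Hz m : continuous (z m) /\ vanishes (z m).
  elim: m => [|m [cz z0]]; first by split => // x; exact: cvg_cst.
  have [_ d2 _ v2] := Hstep _ cz z0; split => // x; exact: der_cont (d2 x).
have dz m x : is_derive x 1 (z m.+1) (z1 m x).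
  by have [_ d2 _ _] := Hstep _ (Hz m).1 (Hz m).2; exact: d2.
have dz1 m x : is_derive x 1 (z1 m) (p x * z m x + h x).
  by have [d1 _ _ _] := Hstep _ (Hz m).1 (Hz m).2; exact: d1.
have z10 m : z1 m 0 = 0.
  by have [_ _ v1 _] := Hstep _ (Hz m).1 (Hz m).2; exact: v1.
have z0 m : z m 0 = 0 by apply: (Hz m).2.
have rate T : exists2 B, 0 <= B & forall x m, 0 <= x <= T ->
    `|z m.+1 x - z m x| <= B / 2 ^+ m.
  have [K K0 HK] := continuous_bounded p T cp.
  have [D D0 HD] := continuous_bounded (z 1%N) T (Hz 1%N).1.
  (* This choice gives [K / L ^ 2 <= 1 / 2], so consecutive iterates contract by a factor 2 in the
     weighted norm. *)
  pose L := 2 * (K + 1); have L0 : 0 < L by rewrite /L; lra.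
  have E m x : 0 <= x <= T -> `|z m.+1 x - z m x| <= D / 2 ^+ m * expR (L * x).
    elim: m x => [|m IH] x x0T.
      rewrite expr0 divr1 {2}/z subr0; apply: (le_trans (HD x x0T)).
      apply: ler_peMr; first exact: ltW.
      by rewrite -expR0 ler_expR mulr_ge0 ?(ltW L0) //; case/andP: x0T.
    have A0 : 0 <= D / 2 ^+ m by rewrite divr_ge0 ?exprn_ge0 ?ltW.
    have KA0 : 0 <= K * (D / 2 ^+ m) by rewrite mulr_ge0 // ltW.
    have E1 y : 0 <= y <= T ->
        `|z1 m.+1 y - z1 m y| <= K * (D / 2 ^+ m) / L * expR (L * y).
      apply: (exp_bound (fun y => z1 m.+1 y - z1 m y)
        (fun y => (p y * z m.+1 y + h y) - (p y * z m y + h y)) T) => //.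
        by rewrite !z10 subr0.
      move=> t t0T; have -> : p t * z m.+1 t + h t - (p t * z m t + h t) =
        p t * (z m.+1 t - z m t) by ring.
      by rewrite normrM -mulrA ler_pM // ?HK // IH.
    have E2 : `|z m.+2 x - z m.+1 x| <= K * (D / 2 ^+ m) / L / L * expR (L * x).
      apply: (exp_bound (fun y => z m.+2 y - z m.+1 y)
        (fun y => z1 m.+1 y - z1 m y) T _ L _ _ L0 _ E1 x x0T).
      + by rewrite !z0 subr0.
      + by rewrite divr_ge0 // ltW.
    apply: (le_trans E2).
    rewrite ler_wpM2r ?expR_ge0 //.
    have -> : K * (D / 2 ^+ m) / L / L = (D / 2 ^+ m) * (K / L / L) by ring.
    have -> : D / 2 ^+ m.+1 = (D / 2 ^+ m) * 2^-1 by rewrite exprS invfM mulrA mulrAC.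
    by rewrite ler_wpM2l // !ler_pdivrMr // /L; nra.
  exists (D * expR (L * T)) => [|x m x0T]; first by rewrite mulr_ge0 ?expR_ge0 ?ltW.
  apply: (le_trans (E m x x0T)); rewrite mulrAC ler_wpM2r ?invr_ge0 ?exprn_ge0 //.
  by rewrite ler_wpM2l ?(ltW D0) // ler_expR ler_wpM2l ?(ltW L0) //; case/andP: x0T.
have lim T : exists2 B, 0 <= B & forall x, 0 <= x <= T -> exists l,
    forall m, `|z m x - l| <= B / 2 ^+ m.
  have [B B0 HB] := rate T; exists (2 * B) => [|x x0T]; first exact: mulr_ge0.
  by apply: geometric_limit => // m; exact: HB.
have /choice [Z HZ] x : exists l, exists B, forall m, `|z m x - l| <= B / 2 ^+ m.
  have [x0|x0] := leP x 1.
    by exists 0, 0 => m; rewrite (Hz m).2 // subrr normr0 mul0r.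
  have [B B0 /(_ x) [|l Hl]] := lim x; last by exists l, B.
  by rewrite lexx andbT; lra.
have rateZ T : exists2 B, 0 <= B & forall x m, x <= T -> `|z m x - Z x| <= B / 2 ^+ m.
  have [B B0 HB] := lim T; exists B => // x m xT; have [B' HB'] := HZ x.
  have [x0|x0] := leP 0 x.
    have [|l Hl] := HB x; first by rewrite x0.
    by rewrite (geometric_limit_unique _ _ _ _ _ HB' Hl).
  suff -> : Z x = 0.
    by rewrite (Hz m).2 ?subrr ?normr0 ?divr_ge0 ?exprn_ge0 //; lra.
  apply: (geometric_limit_unique _ _ _ _ 0 HB') => k.
  by rewrite (Hz k).2 ?subrr ?normr0 ?mul0r //; lra.
have cZ : continuous Z.
  move=> x; apply/cvgrPdist_le => e e0.
  have [B B0 HB] := rateZ (x + 1).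
  have [m Hm] : exists m, B / 2 ^+ m <= e / 3.
    apply: contrapT => nex; suff : e / 3 <= 0 by lra.
    apply: (@le_geometric _ _ B) => m; rewrite leNgt; apply/negP => lt.
    by apply: nex; exists m; exact: ltW.
  have e3 : 0 < e / 3 by lra.
  near=> y; have -> : Z x - Z y = - (z m x - Z x) + (z m x - z m y) + (z m y - Z y) by ring.
  have h1 := HB x m; have h2 := HB y m.
  have h3 : `|z m x - z m y| <= e / 3.
    by near: y; apply: cvgr_dist_le => //; exact: (Hz m).1.
  have yx : y <= x + 1 by apply: ltW; near: y; apply: lt_nbhsl; lra.
  apply: (le_trans (ler_normD _ _)); apply: (le_trans (lerD (ler_normD _ _) (h2 yx))).
  by rewrite normrN; have := h1 ltac:(lra); lra.
have Z0 : vanishes Z.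
  move=> x x1; have [B HB] := HZ x.
  apply: (geometric_limit_unique _ _ _ _ 0 HB) => k.
  by rewrite (Hz k).2 ?subrr ?normr0 ?mul0r //; lra.
have [d1 d2 v1 v2] := Hstep Z cZ Z0.
(* The limit is a fixed point: [z m.+1 x] converges geometrically to [Z x] and also to
   [(step Z).2 x], the latter by two plain integrations of the error in [z m]. *)
suff E : (step Z).2 = Z.
  by exists Z, (step Z).1; split => // x; rewrite -{1}E; exact: d2.
apply/funext => x; have [x1|x1] := leP x 1; first by rewrite v2 // Z0.
have [B HB] := HZ x; have [B' B'0 HB'] := rateZ x; have [K K0 HK] := continuous_bounded p x cp.
have x0 : 0 <= x by lra.
apply: (geometric_limit_unique (fun m => z m.+1 x) _ _ (K * B' * x * x) B) => m; last first.
  apply: (le_trans (HB m.+1)); rewrite exprS invfM mulrCA.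
  have : 0 <= B / 2 ^+ m by apply: le_trans (HB m).
  by move: (B / _) => c; lra.
have -> : K * B' * x * x / 2 ^+ m = K * (B' / 2 ^+ m) * x * x by ring.
have c0 : 0 <= B' / 2 ^+ m by rewrite divr_ge0 // exprn_ge0.
apply: (lin_bound (fun y => z m.+1 y - (step Z).2 y) (fun y => z1 m y - (step Z).1 y)).
- by rewrite z0 v2 // subr0.
- by rewrite !mulr_ge0 ?invr_ge0 ?exprn_ge0 // ltW.
- apply: (lin_bound (fun y => z1 m y - (step Z).1 y)
    (fun y => (p y * z m y + h y) - (p y * Z y + h y))).
  + by rewrite z10 v1 // subr0.
  + by rewrite mulr_ge0 // ltW.
  move=> y /andP[y0 yx]; have -> : p y * z m y + h y - (p y * Z y + h y) =
    p y * (z m y - Z y) by ring.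
  by rewrite normrM ler_pM ?HK ?HB' // y0.
- by rewrite x0 lexx.
Unshelve. all: by end_near. Qed.

(* [u'' = (q - k^2) u] written as a system for [u] and [v = u' / k]. *)
Definition solves q (k : R) (u v : R -> R) :=
  (forall x, is_derive x 1 u (k * v x)) /\
  (forall x, is_derive x 1 v (- k * u x + q x / k * u x)).

(** Subtracting the free solution [a * cos + b * sin] leaves an equation with zero data and
    inhomogeneity [q * uf]. The latter vanishes for [x <= 1], as [picard] requires. *)
Lemma solution_exists q (k a b : R) : continuous q -> vanishes q -> 0 < k ->
  exists u v, [/\ solves q k u v, u 0 = a & v 0 = b].
Proof.
move=> cq q0 k0.
have dk x : is_derive x 1 (fun y : R => k * y) k.
  by apply: der_eq (derMl k (der_id x)) _; rewrite mulr1.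
have dcos x : is_derive x 1 (fun y => cos (k * y)) (- sin (k * x) * k).
  by apply: (der_comp cos).
have dsin x : is_derive x 1 (fun y => sin (k * y)) (cos (k * x) * k).
  by apply: (der_comp sin).
pose uf x := a * cos (k * x) + b * sin (k * x).
pose vf x := b * cos (k * x) - a * sin (k * x).
have duf x : is_derive x 1 uf (k * vf x).
  apply: der_eq (derD (derMl a (dcos x)) (derMl b (dsin x))) _.
  by rewrite /vf; ring.
have dvf x : is_derive x 1 vf (- k * uf x).
  apply: der_eq (derB (derMl b (dcos x)) (derMl a (dsin x))) _.
  by rewrite /uf; ring.
have [|||z [z1 [dz dz1 vz vz1]]] := picard (fun x => q x - k ^+ 2) (fun x => q x * uf x).
- by move=> x; apply: cvgB; [exact: cq | exact: cvg_cst].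
- by move=> x; apply: cvgM; [exact: cq | exact: der_cont (duf x)].
- by move=> x x1; rewrite q0 // mul0r.
exists (fun x => uf x + z x), (fun x => vf x + k^-1 * z1 x); split.
- split=> x.
    apply: der_eq (derD (duf x) (dz x)) _.
    by field; rewrite gt_eqF.
  apply: der_eq (derD (dvf x) (derMl k^-1 (dz1 x))) _.
  by field; rewrite gt_eqF.
- by rewrite /uf mulr0 cos0 sin0 vz //; ring.
- by rewrite /vf mulr0 cos0 sin0 vz1 //; ring.
Qed.

(** The product [E x * expR (- M * x)] is nonincreasing. No sign is imposed on [E] or [M]:
    [energy_gt0] takes minus the energy and a negative rate to obtain a lower bound. *)
Lemma gronwall (E dE : R -> R) T M : 
  (forall x, is_derive x 1 E (dE x)) ->
  (forall x, 0 <= x <= T -> dE x <= M * E x) ->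
  forall x, 0 <= x <= T -> E x * expR (- M * x) <= E 0.
Proof.
move=> dEE le x /andP[x0 xT].
have -> : E 0 = E 0 * expR (- M * 0) by rewrite mulr0 expR0 mulr1.
have dexp y : is_derive y 1 (fun y => expR (- M * y)) (- M * expR (- M * y)).
  apply: der_eq (der_comp expR (is_derive_expR _) (derMl (- M) (der_id y))) _.
  by ring.
apply: (der_le0 (fun y => E y * expR (- M * y))
  (fun y => dE y * expR (- M * y) + E y * (- M * expR (- M * y))) 0 x x0).
  by move=> y _; exact: derM (dEE y) (dexp y).
move=> y /andP[y0 yx]; have := le y; rewrite y0 (le_trans yx xT) => /(_ isT) h.
have -> : dE y * expR (- M * y) + E y * (- M * expR (- M * y)) =
  (dE y - M * E y) * expR (- M * y) by ring.
by rewrite mulr_le0_ge0 ?expR_ge0 // subr_le0.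
Qed.

Definition energy (u v : R -> R) x := u x ^+ 2 + v x ^+ 2.

Lemma energy_der q k u v x : 0 < k -> solves q k u v ->
  is_derive x 1 (energy u v) (q x / k * (2 * (u x * v x))).
Proof.
move=> k0 [du dv]; apply: der_eq (derD (derM (du x) (du x))
  (derM (dv x) (dv x))) _.
by ring.
Qed.

Lemma energy_le q k u v x : 0 < k ->
  `|q x / k * (2 * (u x * v x))| <= `|q x| / k * energy u v x.
Proof.
move=> k0; rewrite normrM normf_div (gtr0_norm k0) ler_wpM2l ?divr_ge0 ?(ltW k0) //.
rewrite /energy ler_norml; apply/andP; split.
  have := sqr_ge0 (u x + v x); lra.
have := sqr_ge0 (u x - v x); lra.
Qed.

(** For [x <= 0] the potential is zero and the energy constant; for [x > 0] it can decrease at most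
    exponentially. *)
Lemma energy_gt0 q k u v : continuous q -> vanishes q -> 0 < k -> solves q k u v ->
  0 < energy u v 0 -> forall x, 0 < energy u v x.
Proof.
move=> cq q0 k0 S E0 x; have [x0|x0] := leP 0 x; last first.
  suff -> : energy u v x = energy u v 0 by [].
  have [|c /andP[_ c0] /eqP] := mvt (energy u v) (fun y => q y / k * (2 * (u y * v y))) x 0 (ltW x0).
    by move=> y _; exact: energy_der.
  by rewrite q0 ?(le_trans c0) // !mul0r subr_eq0 => /eqP.
have [M M0 HM] := continuous_bounded q x cq.
have D y := derN (energy_der q k u v y k0 S).
have := gronwall (fun y => - energy u v y) _ x (- (M / k)) D.
have le y : 0 <= y <= x -> - (q y / k * (2 * (u y * v y))) <= - (M / k) * - energy u v y.
  move=> yx; rewrite mulrNN.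
  apply: (le_trans (ler_norm _)); rewrite normrN; apply: (le_trans (energy_le q k u v y k0)).
  rewrite ler_wpM2r ?addr_ge0 ?sqr_ge0 //.
  by rewrite ler_pM2r ?invr_gt0 // HM.
move=> /(_ le x); rewrite x0 lexx => /(_ isT); rewrite mulNr lerN2 => h.
by have := lt_le_trans E0 h; rewrite pmulr_lgt0 ?expR_gt0.
Qed.

(** This is causality: solutions on [[0, T]] depend only on the potential there, which is what makes
    the delayed equation solvable. The energy of the difference starts at 0 and satisfies a Gronwall
    inequality. *)
Lemma solution_unique q1 q2 k u1 v1 u2 v2 T : continuous q1 -> 0 < k ->
  (forall x, 0 <= x <= T -> q1 x = q2 x) ->
  solves q1 k u1 v1 -> solves q2 k u2 v2 -> u1 0 = u2 0 -> v1 0 = v2 0 ->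
  forall x, 0 <= x <= T -> u1 x = u2 x /\ v1 x = v2 x.
Proof.
move=> cq k0 q12 [du1 dv1] [du2 dv2] u0 v0 x xT.
pose u y := u1 y - u2 y; pose v y := v1 y - v2 y.
have [M M0 HM] := continuous_bounded q1 T cq.
have dE y : is_derive y 1 (energy u v) (2 * u y * (k * v y) + 2 * v y *
    ((- k * u1 y + q1 y / k * u1 y) - (- k * u2 y + q2 y / k * u2 y))).
  have du : is_derive y 1 u (k * v1 y - k * v2 y) by exact: derB.
  have dv : is_derive y 1 v ((- k * u1 y + q1 y / k * u1 y) - (- k * u2 y + q2 y / k * u2 y)).
    exact: derB.
  apply: der_eq (derD (derM du du) (derM dv dv)) _.
  by rewrite /u /v; ring.
have := gronwall _ _ T (M / k) dE.
have le y : 0 <= y <= T -> 2 * u y * (k * v y) + 2 * v y *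
    ((- k * u1 y + q1 y / k * u1 y) - (- k * u2 y + q2 y / k * u2 y)) <= M / k * energy u v y.
  move=> yT; rewrite -q12 //.
  have -> : 2 * u y * (k * v y) + 2 * v y * ((- k * u1 y + q1 y / k * u1 y) -
    (- k * u2 y + q1 y / k * u2 y)) = q1 y / k * (2 * (u y * v y)) by rewrite /u /v; ring.
  apply: (le_trans (ler_norm _)); apply: (le_trans (energy_le q1 k u v y k0)).
  rewrite ler_wpM2r ?addr_ge0 ?sqr_ge0 //.
  by rewrite ler_pM2r ?invr_gt0 // HM.
move=> /(_ le x xT).
have -> : energy u v 0 = 0 by rewrite /energy /u /v u0 v0 !subrr expr0n addr0.
rewrite pmulr_lle0 ?expR_gt0 // /energy => h.
have hu : u x ^+ 2 = 0 by have := sqr_ge0 (u x); have := sqr_ge0 (v x); lra.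
have hv : v x ^+ 2 = 0 by have := sqr_ge0 (u x); have := sqr_ge0 (v x); lra.
move: hu hv => /eqP; rewrite sqrf_eq0 subr_eq0 => /eqP -> /eqP.
by rewrite sqrf_eq0 subr_eq0 => /eqP ->.
Qed.

Lemma solution_Cn q k u v : smooth q -> solves q k u v ->
  forall n, Cn n u /\ Cn n v.
Proof.
move=> sq [du dv]; elim=> [|n [Cu Cv]].
  by split=> x; [exact: der_cont (du x) | exact: der_cont (dv x)].
split; [exists (fun x => k * v x) | exists (fun x => - k * u x + q x / k * u x)];
    split=> //.
- by apply: CnM => //; exact: Cn_cst.
- apply: CnD; first by apply: CnM => //; exact: Cn_cst.
  by apply: CnM => //; apply: CnM; [exact: sq | exact: Cn_cst].
Qed.

End LinearODE.

(** * Phases *)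

Section Phases.
Context {R : realType}.
Implicit Types (q u v P Q : R -> R) (k ki kj x t : R) (Pi Qi Pj Qj : R -> R).

(* In the Pruefer variables [u = r sin th], [v = r cos th] these are
   [P = sin (2 th)] and [Q = cos (2 th)]. *)
Definition sin2 u v x := 2 * (u x * v x) / energy u v x.
Definition cos2 u v x := (v x ^+ 2 - u x ^+ 2) / energy u v x.

(** This is [th' = k - (q / k) * sin th ^ 2] for [P = sin (2 th)] and [Q = cos (2 th)], expressed
    without choosing an angle; note that [1 - Q - P ^ 2 = - Q * (1 - Q)] on the unit circle. *)
Definition phase q k P Q :=
  [/\ forall x, P x ^+ 2 + Q x ^+ 2 = 1,
      forall x, is_derive x 1 P (2 * k * Q x + q x / k * (1 - Q x - P x ^+ 2)) &
      forall x, is_derive x 1 Q (- (2 * k * P x) + q x / k * (P x - P x * Q x))].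

Lemma solves_phase q k u v : 0 < k -> solves q k u v -> (forall x, 0 < energy u v x) ->
  phase q k (sin2 u v) (cos2 u v).
Proof.
move=> k0 S E0; have En x : u x ^+ 2 + v x ^+ 2 != 0 by rewrite gt_eqF // E0.
have [du dv] := S; have kn : k != 0 by rewrite gt_eqF.
split=> x.
- by rewrite /sin2 /cos2 /energy; field; exact: En.
- apply: der_eq (derM (derMl 2 (derM (du x) (dv x)))
    (derV (f := energy u v) (lt0r_neq0 (E0 x)) (energy_der q k u v x k0 S))) _.
  by rewrite /sin2 /cos2 /energy; field; rewrite kn En.
- apply: der_eq (derM (derB (derM (dv x) (dv x)) (derM (du x) (du x)))
    (derV (f := energy u v) (lt0r_neq0 (E0 x)) (energy_der q k u v x k0 S))) _.
  by rewrite /sin2 /cos2 /energy; field; rewrite kn En.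
Qed.

Lemma ln_energy_der q k u v x : 0 < k -> solves q k u v -> 0 < energy u v x ->
  is_derive x 1 (fun y => ln (energy u v y)) (q x / k * sin2 u v x).
Proof.
move=> k0 S E0.
have dln : is_derive (energy u v x) 1 (@ln R) (energy u v x)^-1 by exact: is_derive1_ln.
apply: der_eq (der_comp (@ln R) dln (energy_der q k u v x k0 S)) _.
by rewrite /sin2; field; rewrite !gt_eqF.
Qed.

Lemma phase_le1 q k P Q x : phase q k P Q -> `|P x| <= 1 /\ `|Q x| <= 1.
Proof.
move=> [/(_ x) E _ _]; have a := sqr_ge0 (P x); have b := sqr_ge0 (Q x).
by split; rewrite -(expr_le1 (n := 2)) // real_normK ?num_real //; lra.
Qed.

Lemma phase_err q k P Q x : phase q k P Q ->
  `|1 - Q x - P x ^+ 2| <= 2 /\ `|P x - P x * Q x| <= 2.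
Proof.
move=> H; have [p1 q1] := phase_le1 q k P Q x H; have [/(_ x) E _ _] := H.
have -> : 1 - Q x - P x ^+ 2 = Q x ^+ 2 - Q x by rewrite -E; ring.
have E1 : P x - P x * Q x = P x * (1 - Q x) by ring.
have E2 : Q x ^+ 2 - Q x = Q x * (Q x - 1) by ring.
by split; rewrite ?E1 ?E2 normrM; move: p1 q1; rewrite !ler_norml => /andP[? ?] /andP[? ?];
  rewrite -[leRHS]mul1r ler_pM ?normr_ge0 // ler_norml; apply/andP; split; lra.
Qed.

(* The value at [t] of the unperturbed rotation through the phase at [t - 1]. *)
Definition forecast k P Q t := cos (2 * k) * P (t - 1) + sin (2 * k) * Q (t - 1).

Lemma forecast_le2 q k P Q t : phase q k P Q -> `|forecast k P Q t| <= 2.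
Proof.
move=> H; have [p1 q1] := phase_le1 q k P Q (t - 1) H.
have c1 : `|cos (2 * k)| <= 1 by rewrite ler_norml cos_geN1 cos_le1.
have s1 : `|sin (2 * k)| <= 1 by rewrite ler_norml sin_geN1 sin_le1.
apply: (le_trans (ler_normD _ _)); rewrite !normrM.
rewrite [leRHS](_ : _ = 1 * 1 + 1 * 1); last by ring.
by apply: lerD; apply: ler_pM.
Qed.

(** Let [G s] be the value at time [t] of the free rotation started from the phase at time [s]. It
    joins the forecast at [s = t - 1] to [P t] at [s = t], and its derivative contains only the
    terms with [q], so the mean value theorem applies. *)
Lemma forecast_close q k P Q t : 0 < k -> phase q k P Q ->
  exists2 s, t - 1 <= s <= t & `|P t - forecast k P Q t| <= 4 / k * `|q s|.
Proof.
move=> k0 H; have [E dP dQ] := H.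
pose al x := 1 - Q x - P x ^+ 2; pose be x := P x - P x * Q x.
pose G s := cos (2 * k * (t - s)) * P s + sin (2 * k * (t - s)) * Q s.
have da (s : R) : is_derive s 1 (fun s => 2 * k * (t - s)) (- (2 * k)).
  by apply: der_eq (derMl (2 * k) (derB (der_cst t s) (der_id s))) _; ring.
have dG (s : R) : is_derive s 1 G
    (q s / k * (cos (2 * k * (t - s)) * al s + sin (2 * k * (t - s)) * be s)).
  have dc := der_comp (@cos R) (is_derive_cos _) (da s).
  have ds := der_comp (@sin R) (is_derive_sin _) (da s).
  apply: der_eq (derD (derM dc (dP s)) (derM ds (dQ s))) _.
  by rewrite /al /be; ring.
have t1 : t - 1 <= t by lra.
have [s st] := mvt G _ _ _ t1 (fun s _ => dG s).
have -> : G t = P t by rewrite /G subrr mulr0 cos0 sin0; ring.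
have -> : G (t - 1) = forecast k P Q t.
  by rewrite /G /forecast; have -> : 2 * k * (t - (t - 1)) = 2 * k by ring.
move=> ->; exists s => //; have [a2 b2] := phase_err q k P Q s H.
have -> : t - (t - 1) = 1 by ring.
rewrite mulr1 normrM normf_div (gtr0_norm k0).
have -> : 4 / k * `|q s| = `|q s| / k * 4 by ring.
rewrite ler_wpM2l ?divr_ge0 ?(ltW k0) //.
apply: (le_trans (ler_normD _ _)); rewrite !normrM.
have c1 : `|cos (2 * k * (t - s))| <= 1 by rewrite ler_norml cos_geN1 cos_le1.
have s1 : `|sin (2 * k * (t - s))| <= 1 by rewrite ler_norml sin_geN1 sin_le1.
rewrite [leRHS](_ : _ = 1 * 2 + 1 * 2); last by ring.
by apply: lerD; apply: ler_pM.
Qed.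

(* [osc i j] is a bounded antiderivative of the resonance term
   [(k i / k j) * P i * P j], up to its mean [(i == j) / 2] and an error of size [|q|]. *)
Definition osc (ki kj : R) (Pi Qi Pj Qj : R -> R) x :=
  if ki == kj then - (Pi x * Qi x) / (4 * ki)
  else ki / kj / (2 * (ki ^+ 2 - kj ^+ 2)) * (kj * (Pi x * Qj x) - ki * (Qi x * Pj x)).

(** One constant serves two purposes: the first part of the sum bounds [osc] itself, the second the
    coefficient of [|q|] in the error of its derivative. *)
Definition osc_bound (ki kj : R) : R :=
  if ki == kj then (4 * ki)^-1 + (ki ^+ 2)^-1
  else ki / kj / (2 * `|ki ^+ 2 - kj ^+ 2|) * (ki + kj + (4 + 2 * (kj / ki) + 2 * (ki / kj))).

Lemma osc_bound_ge0 ki kj : 0 < ki -> 0 < kj -> 0 <= osc_bound ki kj.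
Proof.
move=> i0 j0; rewrite /osc_bound; case: ifP => _.
  by rewrite addr_ge0 ?invr_ge0 ?sqr_ge0 // mulr_ge0 // ltW.
rewrite !mulr_ge0 ?invr_ge0 ?mulr_ge0 ?(ltW i0) ?(ltW j0) //.
by rewrite !addr_ge0 ?mulr_ge0 ?invr_ge0 ?(ltW i0) ?(ltW j0).
Qed.

Lemma osc_le q ki kj Pi Qi Pj Qj x : 0 < ki -> 0 < kj ->
  phase q ki Pi Qi -> phase q kj Pj Qj ->
  `|osc ki kj Pi Qi Pj Qj x| <= osc_bound ki kj.
Proof.
move=> i0 j0 Hi Hj; have [pi1 qi1] := phase_le1 q ki Pi Qi x Hi.
have [pj1 qj1] := phase_le1 q kj Pj Qj x Hj.
have c0 : 0 <= (ki ^+ 2)^-1 by rewrite invr_ge0 sqr_ge0.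
have i4 : 0 < 4 * ki by lra.
have r0 : 0 < kj / ki /\ 0 < ki / kj by rewrite !divr_gt0.
rewrite /osc /osc_bound; case: ifP => _.
  rewrite normrM normrN normrM normfV (gtr0_norm i4).
  apply: (@le_trans _ _ (1 * (4 * ki)^-1)); last by rewrite mul1r lerDl.
  by rewrite ler_wpM2r ?invr_ge0 ?(ltW i4) // -[leRHS]mul1r ler_pM.
rewrite normrM normrM [`|ki / kj|]gtr0_norm ?divr_gt0 // normfV normrM (gtr0_norm (_ : 0 < 2)) //.
rewrite ler_wpM2l ?mulr_ge0 ?invr_ge0 ?mulr_ge0 ?(ltW i0) ?(ltW j0) //.
apply: (le_trans (ler_normB _ _)); rewrite !normrM (gtr0_norm i0) (gtr0_norm j0).
have h1 : kj * (`|Pi x| * `|Qj x|) <= kj * 1.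
  by rewrite ler_pM2l // -[leRHS]mul1r ler_pM.
have h2 : ki * (`|Qi x| * `|Pj x|) <= ki * 1.
  by rewrite ler_pM2l // -[leRHS]mul1r ler_pM.
case: r0; lra.
Qed.

(** Under the free rotation [kj * Pi * Qj - ki * Qi * Pj] has derivative
    [2 * (ki ^ 2 - kj ^ 2) * Pi * Pj], because the [Qi * Qj] terms cancel. For equal frequencies,
    [- P * Q / (4 * k)] has derivative [(P ^ 2 - Q ^ 2) / 2 = P ^ 2 - 1 / 2]. All the rest carries a
    factor [q]. *)
Lemma osc_der q ki kj Pi Qi Pj Qj x : 0 < ki -> 0 < kj ->
  phase q ki Pi Qi -> phase q kj Pj Qj -> (ki = kj -> Pi = Pj /\ Qi = Qj) ->
  exists2 d, is_derive x 1 (osc ki kj Pi Qi Pj Qj) d &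
    `|d - (ki / kj * (Pi x * Pj x) - (ki == kj)%:R / 2)| <= osc_bound ki kj * `|q x|.
Proof.
move=> i0 j0 Hi Hj eqij; have [pi1 qi1] := phase_le1 q ki Pi Qi x Hi.
have [pj1 qj1] := phase_le1 q kj Pj Qj x Hj.
have [ai bi] := phase_err q ki Pi Qi x Hi; have [aj bj] := phase_err q kj Pj Qj x Hj.
have [Ei dPi dQi] := Hi; have [Ej dPj dQj] := Hj.
have ni : ki != 0 by rewrite gt_eqF.
have nj : kj != 0 by rewrite gt_eqF.
rewrite /osc /osc_bound; have [eij|nij] := eqVneq ki kj.
  have [E1 E2] := eqij eij; subst kj Pj Qj.
  have db := derM (derN (derM (dPi x) (dQi x))) (der_cst (4 * ki)^-1 x).
  exists (- ((2 * ki * Qi x + q x / ki * (1 - Qi x - Pi x ^+ 2)) * Qi x +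
    Pi x * (- (2 * ki * Pi x) + q x / ki * (Pi x - Pi x * Qi x))) / (4 * ki)).
    by apply: der_eq db _; ring.
  have i2 : 0 < (ki ^+ 2)^-1 by rewrite invr_gt0 exprn_gt0.
  have i4 : 0 < (4 * ki)^-1 by rewrite invr_gt0; lra.
  set d := _ - _; have -> : d = - (q x * (4 * ki ^+ 2)^-1 *
     ((1 - Qi x - Pi x ^+ 2) * Qi x + Pi x * (Pi x - Pi x * Qi x))).
    have EQ : 1 / 2 = (Pi x ^+ 2 + Qi x ^+ 2) / 2 by rewrite Ei.
    by rewrite /d EQ; field.
  rewrite normrN normrM normrM normfV normrM (gtr0_norm (_ : 0 < 4)) //.
  rewrite (ger0_norm (sqr_ge0 _)) invfM -mulrA mulrC; apply: ler_pM => //.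
    by rewrite !mulr_ge0 ?invr_ge0 ?sqr_ge0.
  have h : `|(1 - Qi x - Pi x ^+ 2) * Qi x + Pi x * (Pi x - Pi x * Qi x)| <= 2 * 1 + 1 * 2.
    apply: (le_trans (ler_normD _ _)); rewrite !normrM.
    by apply: lerD; apply: ler_pM.
  move: (`|_|) h (normr_ge0 ((1 - Qi x - Pi x ^+ 2) * Qi x + Pi x * (Pi x - Pi x * Qi x))).
  move=> c h c0; nra.
pose D := 2 * (ki ^+ 2 - kj ^+ 2).
have sq : ki ^+ 2 - kj ^+ 2 != 0.
  by rewrite subr_sqr mulf_neq0 // ?subr_eq0 // gt_eqF // addr_gt0.
have D0 : D != 0 by rewrite mulf_neq0.
have db := derMl (ki / kj / D) (derB (derMl kj (derM (dPi x) (dQj x)))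
   (derMl ki (derM (dQi x) (dPj x)))).
eexists; first exact: db.
set d := _ - _; have -> : d = ki / kj / D * q x *
   (kj / ki * ((1 - Qi x - Pi x ^+ 2) * Qj x) + Pi x * (Pj x - Pj x * Qj x) -
    ((Pi x - Pi x * Qi x) * Pj x + ki / kj * (Qi x * (1 - Qj x - Pj x ^+ 2)))).
  by rewrite /d /D mul0r subr0; field; rewrite ni nj sq.
rewrite normrM normrM normrM normfV [`|ki / kj|]gtr0_norm ?divr_gt0 //.
rewrite /D normrM (gtr0_norm (_ : 0 < 2)) // [leRHS]mulrAC.
apply: ler_pM => //; first by rewrite !mulr_ge0 ?invr_ge0 ?mulr_ge0 ?(ltW i0) ?(ltW j0).
have [r1 r2] : 0 < kj / ki /\ 0 < ki / kj by rewrite !divr_gt0.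
apply: (le_trans (ler_normB _ _)); apply: (le_trans (lerD (ler_normD _ _) (ler_normD _ _))).
rewrite !normrM -!mulrA.
have h1 : `|kj / ki| * (`|1 - Qi x - Pi x ^+ 2| * `|Qj x|) <= kj / ki * (2 * 1).
  by rewrite gtr0_norm // ler_wpM2l ?(ltW r1) // ler_pM.
have h2 : `|Pi x| * `|Pj x - Pj x * Qj x| <= 1 * 2 by rewrite ler_pM.
have h3 : `|Pi x - Pi x * Qi x| * `|Pj x| <= 2 * 1 by rewrite ler_pM.
have h4 : `|ki / kj| * (`|Qi x| * `|1 - Qj x - Pj x ^+ 2|) <= ki / kj * (1 * 2).
  by rewrite gtr0_norm // ler_wpM2l ?(ltW r2) // ler_pM.
move: h1 h4; rewrite !normrM -!mulrA => h1 h4.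
by move: (lerD (lerD h1 h2) (lerD h3 h4)); lra.
Qed.

End Phases.

(** * Decay of the amplitudes *)

Section Decay.
Context {R : realType}.
Variables (k X : nat -> R) (a : nat -> bool).
Hypothesis k_inj : injective k.
Hypothesis k_gt0 : forall i, 0 < k i.
Hypothesis X_ge1 : forall i, 1 <= X i.
Implicit Types (i j N : nat) (s t x : R).

Definition wt i t : R := if a i then weight (X i) t else 0.
Definition dwt i t : R := if a i then dweight (X i) t else 0.
Definition root4 t : R := Num.sqrt (Num.sqrt t).
Definition switched i t : R := (X i < t)%R%:R.

Hypothesis sum_k : forall N t, 1 <= t ->
  \sum_(i < N) switched i t * (k i + 1) <= 2 * root4 t.
Hypothesis sum_osc : forall j, exists2 D, 0 <= D & forall N t, 1 <= t ->
  \sum_(i < N) switched i t * osc_bound (k i) (k j) <= D * root4 t.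

Lemma wt_der i t : is_derive t 1 (wt i) (dwt i t).
Proof.
rewrite /wt /dwt; case: (a i); first exact: weight_der.
exact: der_cst.
Qed.

Lemma wt_off i t : t <= X i -> wt i t = 0.
Proof.
by move=> tX; rewrite /wt; case: ifP => // _; apply: (weight_off _ _ _ tX).1; apply: lt_le_trans (X_ge1 i).
Qed.

Lemma switched_ge0 i t : 0 <= switched i t. Proof. exact: ler0n. Qed.

Lemma wt_bound i t : 0 < t -> 0 <= wt i t /\ wt i t <= switched i t * (8 / t).
Proof.
move=> t0; have X0 : 0 < X i by apply: lt_le_trans (X_ge1 i).
have h : 0 <= switched i t * (8 / t) by rewrite mulr_ge0 ?switched_ge0 // divr_ge0 // ltW.
rewrite /wt; case: (a i) => //; split; first by apply: weight_ge0; exact: ltW.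
have [tX|Xt] := leP t (X i); first by rewrite (weight_off _ _ X0 tX).1.
by rewrite /switched Xt mul1r weight_le.
Qed.

Lemma dwt_bound i t : 0 < t -> `|dwt i t| <= switched i t * (40 / t ^+ 2).
Proof.
move=> t0; have X0 : 0 < X i by apply: lt_le_trans (X_ge1 i).
have h : 0 <= switched i t * (40 / t ^+ 2).
  by rewrite mulr_ge0 ?switched_ge0 // divr_ge0 // sqr_ge0.
rewrite /dwt; case: (a i); last by rewrite normr0.
have [tX|Xt] := leP t (X i); first by rewrite (weight_off _ _ X0 tX).2 normr0.
by rewrite /switched Xt mul1r dweight_le.
Qed.

Lemma root4_ge1 t : 1 <= t -> 1 <= root4 t.
Proof.
have h x : 1 <= x -> 1 <= Num.sqrt x by move=> x1; rewrite -sqrtr1; exact: ler_wsqrtr.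
by move=> t1; rewrite /root4 !h.
Qed.

Lemma root4_sqr t : 0 <= t -> root4 t ^+ 2 = Num.sqrt t.
Proof. by move=> t0; rewrite sqr_sqrtr // sqrtr_ge0. Qed.

Lemma root4_le_id t : 1 <= t -> root4 t <= t.
Proof.
move=> t1; have r1 := root4_ge1 t t1; have t0 : 0 <= t by lra.
have : root4 t <= (root4 t ^+ 2) ^+ 2.
  by rewrite -exprM; apply: ler_eXnr.
by rewrite root4_sqr // sqr_sqrtr.
Qed.

Lemma root4_le s t : s <= t -> root4 s <= root4 t.
Proof. by move=> st; rewrite /root4 !ler_wsqrtr. Qed.

Definition delayed_potential (P Q : nat -> R -> R) N t : R :=
  - \sum_(i < N) k i * wt i t * forecast (k i) (P i) (Q i) t.

Lemma delayed_potential_le (q : R -> R) P Q N t :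
  (forall i, phase q (k i) (P i) (Q i)) -> 0 < t ->
  `|delayed_potential P Q N t| <= \sum_(i < N) k i * wt i t * 2.
Proof.
move=> H t0; rewrite normrN; apply: (le_trans (ler_norm_sum _ _ _)).
apply: ler_sum => i _; have [w0 _] := wt_bound i t t0.
rewrite !normrM (ger0_norm w0) (gtr0_norm (k_gt0 i)).
by rewrite ler_wpM2l ?mulr_ge0 ?(ltW (k_gt0 i)) // (forecast_le2 _ _ _ _ _ (H i)).
Qed.

Variables (q : R -> R) (u v : nat -> R -> R).
Hypothesis sol : forall i, solves q (k i) (u i) (v i).
Hypothesis energy0 : forall i x, 0 < energy (u i) (v i) x.
Let P i := sin2 (u i) (v i).
Let Q i := cos2 (u i) (v i).
(** This replaces an infinite series for [q]: on each half-line every long enough partial sum is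
    already exact. *)
Hypothesis qE : forall T, exists N0, forall N, (N0 <= N)%N -> forall t, t <= T ->
  q t = delayed_potential P Q N t.

Let ph i : phase q (k i) (P i) (Q i).
Proof. exact: solves_phase. Qed.

Lemma potential_le t : 1 <= t -> `|q t| <= 32 * root4 t / t.
Proof.
move=> t1; have t0 : 0 < t by lra.
have [N /(_ N (leqnn N)) ->] := qE t; last by [].
apply: (le_trans (delayed_potential_le _ _ _ _ _ ph t0)).
have -> : 32 * root4 t / t = (2 * root4 t) * (16 / t) by ring.
apply: (@le_trans _ _ ((\sum_(i < N) switched i t * (k i + 1)) * (16 / t))); last first.
  by rewrite ler_wpM2r ?sum_k // divr_ge0 // ltW.
rewrite mulr_suml; apply: ler_sum => i _; have [w0 w1] := wt_bound i t t0.
have ki := ltW (k_gt0 i); have s0 := switched_ge0 i t.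
have tV : 0 <= 8 / t by rewrite divr_ge0 // ltW.
have -> : switched i t * (k i + 1) * (16 / t) = k i * (switched i t * (8 / t)) * 2 +
  switched i t * (8 / t) * 2 by ring.
apply: (@le_trans _ _ (k i * (switched i t * (8 / t)) * 2)).
  by rewrite ler_wpM2r // ler_wpM2l.
by rewrite lerDl mulr_ge0 // mulr_ge0.
Qed.

(** The forecast error involves [q] at an unknown point of [[t - 1, t]]. The constant doubles
    because [s >= t / 2] there. *)
Lemma potential_le_near s t : 2 <= t -> t - 1 <= s <= t -> `|q s| <= 64 * root4 t / t.
Proof.
move=> t2 /andP[ts st]; have s1 : 1 <= s by lra.
apply: (le_trans (potential_le s s1)).
have s0 : 0 < s by lra. have t0 : 0 < t by lra.
have h1 := root4_le s t st; have h2 := root4_ge1 s s1.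
have h3 : s^-1 <= 2 / t by rewrite ler_pdivlMr // mulrC ler_pdivrMr //; lra.
have -> : 64 * root4 t / t = 32 * root4 t * (2 / t) by ring.
by apply: ler_pM => //; [rewrite mulr_ge0 //; lra | rewrite invr_ge0 ltW | rewrite ler_wpM2l].
Qed.

Lemma decay j : a j -> exists C, forall t, 0 <= t ->
  energy (u j) (v j) t * (1 + t ^+ 2) <= C.
Proof.
move=> aj; have kj0 := k_gt0 j; have [D D0 HD] := sum_osc j.
pose c i := osc_bound (k i) (k j).
have c0 i : 0 <= c i by exact: osc_bound_ge0.
pose B i := osc (k i) (k j) (P i) (Q i) (P j) (Q j).
have /choice [d Hd] (ix : nat * R) : exists d, is_derive ix.2 1 (B ix.1) d /\
    `|d - (k ix.1 / k j * (P ix.1 ix.2 * P j ix.2) - (k ix.1 == k j)%:R / 2)|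
       <= c ix.1 * `|q ix.2|.
  have [|d' d1 d2] := osc_der q (k ix.1) (k j) _ _ _ _ ix.2 (k_gt0 ix.1) kj0 (ph ix.1) (ph j).
    by move/k_inj => ->.
  by exists d'.
pose dd (i : nat) t := d (i, t).
have dB i t := (Hd (i, t)).1; have dB_le i t := (Hd (i, t)).2; rewrite /= in dB dB_le.
have B_le i t : `|B i t| <= c i by exact: (osc_le q).
(* The three summands come from the derivatives of the weights, from the errors of [osc_der], and
   from replacing forecasts by true phases. *)
pose M := 40 * D + 8 * (64 * D) + 64 * (64 / k j).
have M0 : 0 <= M.
  have kV : 0 <= (k j)^-1 by rewrite invr_ge0 ltW.
  by rewrite /M; lra.
(* After the correction by the sum of [wt i * B i], only the mean of the resonant term [i = j]
   survives, with an error of order [root4 t ^ 2 / t ^ 2 = t ^ (-3/2)]. *)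
have key N t : (j < N)%N -> 2 <= t -> q t = delayed_potential P Q N t ->
    q t / k j * P j t + \sum_(i < N) (dwt i t * B i t + wt i t * dd i t) <=
    - (wt j t / 2) + M * root4 t ^+ 2 / t ^+ 2.
  move=> jN t2 qtE; have t0 : 0 < t by lra.
  have t1 : 1 <= t by lra.
  set Qb := 64 * root4 t / t.
  have Qt : `|q t| <= Qb by apply: potential_le_near => //; lra.
  have r1 := root4_ge1 t t1.
  have r0 : 0 < root4 t by lra.
  have tV : 0 < t^-1 by rewrite invr_gt0.
  have Qb0 : 0 <= Qb by rewrite (le_trans _ Qt).
  rewrite qtE /delayed_potential mulNr mulNr mulr_suml mulr_suml -sumrN -big_split /=.
  have term i : - (k i * wt i t * forecast (k i) (P i) (Q i) t / k j * P j t) +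
      (dwt i t * B i t + wt i t * dd i t) <=
      switched i t * c i * (40 / t ^+ 2) +
      (switched i t * c i * (8 / t * Qb) +
       switched i t * (32 / k j / t * Qb)) - (k i == k j)%:R * (wt i t / 2).
    have [w0 w1] := wt_bound i t t0; have dw := dwt_bound i t t0.
    have [s st pc] := forecast_close q (k i) _ _ t (k_gt0 i) (ph i).
    have Qs : `|q s| <= Qb by apply: potential_le_near.
    have [pj1 _] := phase_le1 q (k j) _ _ t (ph j).
    have e1 : dwt i t * B i t <= switched i t * c i * (40 / t ^+ 2).
      apply: (le_trans (ler_norm _)); rewrite normrM mulrAC.
      exact: ler_pM.
    set e := dd i t - (k i / k j * (P i t * P j t) - (k i == k j)%:R / 2).
    have e2 : wt i t * e <= switched i t * c i * (8 / t * Qb).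
      have -> : switched i t * c i * (8 / t * Qb) = (switched i t * (8 / t)) * (c i * Qb) by ring.
      apply: (@le_trans _ _ (wt i t * (c i * Qb))).
        rewrite ler_wpM2l // (le_trans (ler_norm _)) // (le_trans (dB_le i t)) //.
        by rewrite ler_wpM2l.
      by rewrite ler_wpM2r // mulr_ge0.
    (* The factor [1 / k i] of [forecast_close] cancels the [k i] of the potential, so summing over
       [i] only counts the terms that are switched on. *)
    have e3 : wt i t * ((k i / k j) * ((P i t - forecast (k i) (P i) (Q i) t) * P j t)) <=
        switched i t * (32 / k j / t * Qb).
      have -> : switched i t * (32 / k j / t * Qb) =
         (switched i t * (8 / t)) * (k i / k j * (4 / k i * Qb * 1)).
        by field; rewrite !gt_eqF.
      have ij0 : 0 <= k i / k j by rewrite divr_ge0 // ltW.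
      apply: (@le_trans _ _ (wt i t * (k i / k j * (4 / k i * Qb * 1)))).
        rewrite ler_wpM2l // ler_wpM2l // (le_trans (ler_norm _)) // normrM.
        apply: ler_pM => //; apply: (le_trans pc).
        by rewrite ler_wpM2l // divr_ge0 // ltW.
      rewrite ler_wpM2r // !mulr_ge0 ?invr_ge0 ?(ltW kj0) // ?ltW //.
    have -> : - (k i * wt i t * forecast (k i) (P i) (Q i) t / k j * P j t) +
      (dwt i t * B i t + wt i t * dd i t) = dwt i t * B i t + (wt i t * e +
      wt i t * ((k i / k j) * ((P i t - forecast (k i) (P i) (Q i) t) * P j t))) -
      (k i == k j)%:R * (wt i t / 2) by rewrite /e; ring.
    by rewrite lerD2r lerD // lerD.
  apply: le_trans; first by apply: ler_sum => i _; exact: term.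
  rewrite big_split /= big_split /= big_split /= sumrN -!mulr_suml.
  have -> : \sum_(i < N) (k i == k j)%:R * (wt i t / 2) = wt j t / 2.
    rewrite (bigD1 (Ordinal jN)) //= eqxx mul1r big1 ?addr0 // => i ij.
    by rewrite (inj_eq k_inj) (_ : (i == j :> nat) = false) ?mul0r //; apply: negbTE.
  rewrite addrC lerD2l.
  have s1 := HD N t t1.
  have s2 : \sum_(i < N) switched i t <= 2 * root4 t.
    apply: (le_trans _ (sum_k N t t1)); apply: ler_sum => i _.
    by rewrite ler_peMr ?switched_ge0 // lerDr ltW.
  have g1 : 0 <= 40 / t ^+ 2 by rewrite divr_ge0 // sqr_ge0.
  have g2 : 0 <= 8 / t * Qb by rewrite mulr_ge0 // divr_ge0 // ltW.
  have g3 : 0 <= 32 / k j / t * Qb by rewrite mulr_ge0 // !divr_ge0 // ltW.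
  apply: (le_trans (lerD (ler_wpM2r g1 s1) (lerD (ler_wpM2r g2 s1) (ler_wpM2r g3 s2)))).
  have -> : M * root4 t ^+ 2 / t ^+ 2 = D * root4 t * (40 / t ^+ 2) * root4 t +
     (D * root4 t * (8 / t * Qb) + 2 * root4 t * (32 / k j / t * Qb)).
    by rewrite /M /Qb; field; rewrite !gt_eqF.
  by rewrite lerD2r ler_peMr // mulr_ge0 // mulr_ge0 // ltW.
(* From here on [weight_lb] gives [wt j t / 2 >= 2 * t / (1 + t ^ 2)]. *)
pose T0 := 3 * X j; have T03 : 3 <= T0 by have := X_ge1 j; rewrite /T0; lra.
pose S N t := \sum_(i < N) wt i t * B i t.
have S_le N t : 1 <= t -> `|S N t| <= 8 * D.
  move=> t1; have t0 : 0 < t by lra.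
  apply: (le_trans (ler_norm_sum _ _ _)).
  apply: (@le_trans _ _ ((\sum_(i < N) switched i t * c i) * (8 / t))).
    rewrite mulr_suml; apply: ler_sum => i _; have [w0 w1] := wt_bound i t t0.
    rewrite normrM (ger0_norm w0).
    have -> : switched i t * c i * (8 / t) = switched i t * (8 / t) * c i by ring.
    by apply: ler_pM.
  apply: (@le_trans _ _ (D * root4 t * (8 / t))).
    by rewrite ler_wpM2r ?HD // divr_ge0 // ltW.
  have -> : D * root4 t * (8 / t) = 8 * D * (root4 t / t) by ring.
  by rewrite ler_piMr ?mulr_ge0 // ler_pdivrMr // mul1r root4_le_id.
(* A nonincreasing quantity on [t >= T0]: the sum [S] removes the oscillation, [ln (1 + t ^ 2)] is
   paid for by [wt j / 2], and the last term has derivative [- M * t ^ (-3/2)], which absorbs the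
   error. *)
pose f N t := ln (energy (u j) (v j) t) + (S N t +
  (ln (1 + t ^+ 2) + 2 * M * (Num.sqrt t)^-1)).
pose df N t := q t / k j * P j t + (\sum_(i < N) (dwt i t * B i t + wt i t * dd i t) +
  ((1 + t ^+ 2)^-1 * (2 * t) - M * root4 t ^+ 2 / t ^+ 2)).
have dff N t : 0 < t -> is_derive t 1 (f N) (df N t).
  move=> t0; have d1 : is_derive t 1 (fun t => ln (1 + t ^+ 2)) ((1 + t ^+ 2)^-1 * (2 * t)).
    have dl : is_derive (1 + t ^+ 2) 1 (@ln R) (1 + t ^+ 2)^-1.
      by apply: is_derive1_ln; exact: oneD_gt0.
    apply: (der_comp (@ln R) (g := fun t => 1 + t ^+ 2) dl).
    apply: der_eq (derD (der_cst 1 t) (derM (der_id t) (der_id t))) _; by ring.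
  have s0 : 0 < Num.sqrt t by rewrite sqrtr_gt0.
  have d2 : is_derive t 1 (fun t => 2 * M * (Num.sqrt t)^-1) (- (M * root4 t ^+ 2 / t ^+ 2)).
    apply: der_eq (derMl (2 * M) (derV (f := @Num.sqrt R) (lt0r_neq0 s0) (is_derive1_sqrt t0))) _.
    rewrite root4_sqr ?(ltW t0) //; move: s0 (sqr_sqrtr (ltW t0)).
    move: (Num.sqrt t) => z z0 <-; by field; rewrite gt_eqF.
  have d3 := der_sum N (fun i t => wt i t * B i t)
    (fun i t => dwt i t * B i t + wt i t * dd i t) t
    (fun i => derM (wt_der i t) (dB i t)).
  exact: derD (ln_energy_der q (k j) (u j) (v j) t kj0 (sol j) (energy0 j t))
    (derD d3 (derD d1 d2)).
pose C1 := ln (energy (u j) (v j) T0) + (8 * D + (ln (1 + T0 ^+ 2) + 2 * M * (Num.sqrt T0)^-1)) + 8 * D.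
have large t : T0 <= t -> energy (u j) (v j) t * (1 + t ^+ 2) <= expR C1.
  move=> Tt; have t0 : 0 < t by lra.
  (* The number of terms may depend on [t], but [S] is bounded by [8 * D] for every [N], so [C1]
     does not depend on it. The two copies of [8 * D] in [C1] bound [S] at [T0] and at [t]. *)
  have [N0 HN] := qE t; pose N := maxn N0 j.+1.
  have le : f N t <= f N T0.
    apply: (der_le0 (f N) (df N) T0 t Tt) => [x /andP[Tx xt]|x /andP[Tx xt]].
      by apply: dff; lra.
    have x2 : 2 <= x by lra.
    have := key N x (leq_maxr _ _) x2 (HN N (leq_maxl _ _) x xt).
    have := weight_lb (X j) x (lt_le_trans ltr01 (X_ge1 j)) Tx.
    have -> : weight (X j) x = wt j x by rewrite /wt aj.
    rewrite /df [x / _]mulrC; set b := _^-1 * x; rewrite (_ : _^-1 * (2 * x) = 2 * b); last by rewrite /b; ring.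
    by move: b (wt j x) (\sum_(_ < _) _) => b w sm; lra.
  have e0 := energy0 j t; have p0 := oneD_gt0 t.
  rewrite -[leLHS]lnK ?posrE ?mulr_gt0 // ler_expR lnM ?posrE //.
  have t1 : 1 <= t by lra.
  have T1 : 1 <= T0 by lra.
  have := S_le N t t1; have := S_le N T0 T1; rewrite !ler_norml => /andP[_ a1] /andP[a2 _].
  have : 0 <= 2 * M * (Num.sqrt t)^-1 by rewrite !mulr_ge0 // invr_ge0 sqrtr_ge0.
  by move: le; rewrite /f /C1; lra.
have cE : continuous (fun t => energy (u j) (v j) t * (1 + t ^+ 2)).
  move=> t; apply: cvgM; first exact: der_cont (energy_der _ _ _ _ t kj0 (sol j)).
  apply: cvgD; first exact: cvg_cst.
  exact: exprn_continuous.
have [K K0 HK] := continuous_bounded _ T0 cE.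
exists (K + expR C1) => t t0; have [tT|Tt] := leP t T0.
  apply: (@le_trans _ _ K); last by rewrite lerDl expR_ge0.
  by apply: (le_trans (ler_norm _)); apply: HK; rewrite t0.
by apply: (le_trans (large t (ltW Tt))); rewrite lerDr ltW.
Qed.

End Decay.

(** * The delayed potential *)

Section Thresholds.
Context {R : realType}.

Lemma sum_half N : \sum_(i < N) (2 ^+ i)^-1 <= 2 :> R.
Proof.
suff -> : \sum_(i < N) (2 ^+ i)^-1 = 2 - 2 / 2 ^+ N :> R.
  by rewrite lerBlDr lerDl divr_ge0 // exprn_ge0.
elim: N => [|N IH]; first by rewrite big_ord0 expr0 divr1 subrr.
rewrite big_ord_recr /= IH exprS invfM.
by move: ((2 ^+ N)^-1) => y; lra.
Qed.

Lemma sum_trunc (F : nat -> R) (n N : nat) : (forall i, 0 <= F i) ->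
  \sum_(i < N) (i < n)%N%:R * F i <= \sum_(i < n) F i.
Proof.
move=> F0; apply: (@le_trans _ _ (\sum_(i < n + N) (i < n)%N%:R * F i)).
  rewrite addnC big_split_ord /= lerDl sumr_ge0 // => i _.
  by rewrite mulr_ge0.
rewrite big_split_ord /= [X in _ + X]big1 ?addr0; last first.
  by move=> i _; rewrite ltnNge leq_addr mul0r.
by apply: ler_sum => i _; rewrite ltn_ord mul1r.
Qed.

Variables (k Y : nat -> R).
Hypothesis k_gt0 : forall i, 0 < k i.

(** The factor [2 ^ i] makes the constants of switched terms summable, [|Y i|] respects the
    prescribed lower bound, [i] makes the family of terms locally finite, and 1 keeps thresholds at
    least 1. The fourth power in [threshold] turns [threshold i < t] into a bound by [root4 t]. *)
Definition threshold_root i : R :=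
  2 ^+ i * (k i + 1 + \sum_(j < i) osc_bound (k i) (k j)) + `|Y i| + i%:R + 1.
Definition threshold i : R := threshold_root i ^+ 4.

Lemma threshold_rootP i : [/\ 1 <= threshold_root i, i%:R <= threshold_root i,
  Y i <= threshold_root i, 2 ^+ i * (k i + 1) <= threshold_root i &
  forall j, (j < i)%N -> 2 ^+ i * osc_bound (k i) (k j) <= threshold_root i].
Proof.
have o0 j : 0 <= osc_bound (k i) (k j) by exact: osc_bound_ge0.
have S0 : 0 <= \sum_(j < i) osc_bound (k i) (k j) by exact: sumr_ge0.
have Sj j : (j < i)%N -> osc_bound (k i) (k j) <= \sum_(j < i) osc_bound (k i) (k j).
  by move=> ji; rewrite (bigD1 (Ordinal ji)) //= lerDl sumr_ge0.
have p0 : 0 < 2 ^+ i :> R by rewrite exprn_gt0.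
have i0 : 0 <= i%:R :> R by [].
have Y0 := normr_ge0 (Y i); have Y1 := ler_norm (Y i); have ki := k_gt0 i.
rewrite /threshold_root; move: S0 Sj; move: (\sum_(_ < _) _) (i%:R) i0 (2 ^+ i) p0 => S I I0 p p0 S0 Sj.
have pk : 0 < p * k i by rewrite mulr_gt0.
have pS : 0 <= p * S by rewrite mulr_ge0 // ltW.
split; [nra | nra | nra | nra |].
move=> j /Sj oS; have : p * osc_bound (k i) (k j) <= p * S by rewrite ler_wpM2l // ltW.
by nra.
Qed.

Lemma threshold_le_root t i : threshold i < t -> threshold_root i <= root4 t.
Proof.
move=> Xt; have [r1 _ _ _ _] := threshold_rootP i.
have r0 : 0 <= threshold_root i by lra.
have h : (threshold_root i ^+ 2) ^+ 2 <= t by rewrite -exprM ltW.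
rewrite -[leLHS]ger0_norm // -sqrtr_sqr /root4 ler_wsqrtr //.
by rewrite -[leLHS]ger0_norm ?sqr_ge0 // -sqrtr_sqr ler_wsqrtr.
Qed.

Lemma threshold_ge i : threshold_root i <= threshold i.
Proof. by rewrite ler_eXnr //; case: (threshold_rootP i). Qed.

Lemma threshold_sum_k N t : 1 <= t ->
  \sum_(i < N) switched threshold i t * (k i + 1) <= 2 * root4 t.
Proof.
move=> t1; have r0 : 0 <= root4 t by rewrite sqrtr_ge0.
apply: (@le_trans _ _ (\sum_(i < N) (2 ^+ i)^-1 * root4 t)); last first.
  by rewrite -mulr_suml ler_wpM2r // sum_half.
apply: ler_sum => i _; rewrite /switched; case: ltP => [Xt|_]; last first.
  by rewrite mul0r mulr_ge0 // invr_ge0 exprn_ge0.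
rewrite mul1r ler_pdivlMl ?exprn_gt0 //; apply: (le_trans _ (threshold_le_root _ _ Xt)).
by case: (threshold_rootP i).
Qed.

(** The threshold of [i] controls [osc_bound (k i) (k j)] only for [j < i]. The finitely many
    indices [i <= j] are put into the constant [D]. *)
Lemma threshold_sum_osc j : exists2 D : R, 0 <= D & forall N t, 1 <= t ->
  \sum_(i < N) switched threshold i t * osc_bound (k i) (k j) <= D * root4 t.
Proof.
have o0 i : 0 <= osc_bound (k i) (k j) by exact: osc_bound_ge0.
pose D := \sum_(i < j.+1) osc_bound (k i) (k j); have D0 : 0 <= D by exact: sumr_ge0.
exists (2 + D) => [|N t t1]; first lra.
have r1 := root4_ge1 t t1; have r0 : 0 <= root4 t by lra.
apply: (@le_trans _ _ (\sum_(i < N) ((2 ^+ i)^-1 + (i < j.+1)%N%:R * osc_bound (k i) (k j)) * root4 t)).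
  apply: ler_sum => i _; have p0 : 0 < (2 ^+ i)^-1 :> R by rewrite invr_gt0 exprn_gt0.
  rewrite /switched; case: ltP => [Xt|_]; last first.
    by rewrite mul0r mulr_ge0 // addr_ge0 ?mulr_ge0 // ltW.
  rewrite mul1r ltnS; case: (leqP i j) => ij.
    rewrite mul1r mulrDl; apply: ler_wpDl; first by rewrite mulr_ge0 // ltW.
    by rewrite ler_peMr.
  rewrite mul0r addr0 ler_pdivlMl ?exprn_gt0 //; apply: (le_trans _ (threshold_le_root _ _ Xt)).
  by case: (threshold_rootP i) => _ _ _ _; apply.
rewrite -mulr_suml ler_wpM2r // big_split /= lerD ?sum_half //.
exact: (sum_trunc (fun i => osc_bound (k i) (k j)) j.+1 N).
Qed.

End Thresholds.

Section Construction.
Context {R : realType}.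
Variables (k X : nat -> R) (a : nat -> bool) (ua va : nat -> R).
Hypothesis k_gt0 : forall i, 0 < k i.
Hypothesis X_ge1 : forall i, 1 <= X i.
Hypothesis X_ge : forall i, i%:R <= X i.
Hypothesis data_gt0 : forall i, 0 < ua i ^+ 2 + va i ^+ 2.
Implicit Types (t x T : R).

(** A single choice of solutions as a function of the potential lets the delayed equation be
    iterated as a map on potentials. *)
Lemma solution_choice : exists sol : (R -> R) -> nat -> (R -> R) * (R -> R),
  forall q i, continuous q -> vanishes q ->
    [/\ solves q (k i) (sol q i).1 (sol q i).2, (sol q i).1 0 = ua i & (sol q i).2 0 = va i].
Proof.
have /choice [s Hs] (qi : (R -> R) * nat) : exists uv : (R -> R) * (R -> R),
    continuous qi.1 -> vanishes qi.1 ->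
    [/\ solves qi.1 (k qi.2) uv.1 uv.2, uv.1 0 = ua qi.2 & uv.2 0 = va qi.2].
  have [[cq vq]|] := pselect (continuous qi.1 /\ vanishes qi.1); last first.
    by move=> nqi; exists (qi.1, qi.1) => cq vq; case: nqi.
  have [u [v H]] := solution_exists qi.1 (k qi.2) (ua qi.2) (va qi.2) cq vq (k_gt0 qi.2).
  by exists (u, v).
by exists (fun q i => s (q, i)) => q i; exact: (Hs (q, i)).
Qed.

Lemma Cn_phase n (u v : R -> R) : (forall x, 0 < energy u v x) ->
  Cn n u -> Cn n v -> Cn n (sin2 u v) /\ Cn n (cos2 u v).
Proof.
move=> E0 Cu Cv; have CE : Cn n (energy u v) by apply: CnD; apply: CnM.
have CEV : Cn n (fun x => (energy u v x)^-1).
  by apply: CnV => // x; rewrite gt_eqF.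
split; apply: CnM => //; first by apply: CnM; [exact: Cn_cst | exact: CnM].
apply: Cn_ext (CnD _ _ _ (CnM _ _ _ Cv Cv) (CnM _ _ _ (Cn_cst n (-1)) (CnM _ _ _ Cu Cu))).
by move=> x; rewrite mulN1r.
Qed.

(* On [t <= n + 1] the delayed right-hand side only involves [q] on [t <= n];
   iterating it therefore stabilises on every half-line. *)
Lemma delayed_fixpoint : exists q u v,
  [/\ smooth q, vanishes q,
      forall i, [/\ solves q (k i) (u i) (v i), u i 0 = ua i & v i 0 = va i],
      forall i x, 0 < energy (u i) (v i) x &
      forall T, exists N0, forall N, (N0 <= N)%N -> forall t, t <= T ->
        q t = delayed_potential k X a (fun i => sin2 (u i) (v i)) (fun i => cos2 (u i) (v i)) N t].
Proof.
have [sol Hsol] := solution_choice.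
pose next q n := delayed_potential k X a (fun i => sin2 (sol q i).1 (sol q i).2)
  (fun i => cos2 (sol q i).1 (sol q i).2) n.
pose qs := fix qs n : R -> R := if n is m.+1 then next (qs m) m.+1 else fun=> 0.
have Epos q i : continuous q -> vanishes q -> forall x, 0 < energy (sol q i).1 (sol q i).2 x.
  move=> cq vq; have [S u0 v0] := Hsol q i cq vq; apply: energy_gt0 S _ => //.
  by rewrite /energy u0 v0.
have next_vanishes q n : vanishes (next q n).
  move=> t t1; rewrite /next /delayed_potential big1 ?oppr0 // => i _.
  by rewrite wt_off ?mulr0 ?mul0r // (le_trans t1).
have next_smooth q n : smooth q -> vanishes q -> smooth (next q n).
  move=> sq vq m; have cq : continuous q by exact: (sq 0%N).
  have Cterm i : Cn m (fun t => k i * wt X a i t *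
      forecast (k i) (sin2 (sol q i).1 (sol q i).2) (cos2 (sol q i).1 (sol q i).2) t).
    have [S _ _] := Hsol q i cq vq; have [Cu Cv] := solution_Cn q (k i) _ _ sq S m.
    have [Cs Cc] := Cn_phase m _ _ (Epos q i cq vq) Cu Cv.
    apply: CnM.
      apply: CnM; first exact: Cn_cst.
      rewrite /wt; case: (a i); [exact: weight_Cn | exact: Cn_cst].
    have shift f : Cn m f -> Cn m (fun t => f (t - 1)).
      by move=> Cf; apply: Cn_ext (Cn_affine m f 1 (-1) Cf) => t; rewrite mul1r.
    by apply: CnD; apply: CnM; [exact: Cn_cst | exact: shift | exact: Cn_cst | exact: shift].
  apply: Cn_ext (CnM _ _ _ (Cn_cst m (-1)) (Cn_sum m n _ Cterm)) => t.
  by rewrite mulN1r.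
have qsP n : smooth (qs n) /\ vanishes (qs n).
  elim: n => [|n [sn vn]]; first by split => // m; exact: Cn_cst.
  by split; [exact: next_smooth | exact: next_vanishes].
(* A forecast at [t] reads the solutions at [t - 1] only, so agreement for [x <= T] propagates to
   [t <= T + 1]. For [t <= 1], where [t - 1] may be negative, all weights vanish. *)
have next_eq q1 q2 n t (T : R) : continuous q1 -> continuous q2 -> vanishes q1 -> vanishes q2 ->
    (forall x, x <= T -> q1 x = q2 x) -> t - 1 <= T -> next q1 n t = next q2 n t.
  move=> c1 c2 v1 v2 E tT; have [t1|t1] := leP t 1; first by rewrite !next_vanishes.
  rewrite /next /delayed_potential; congr (- _); apply: eq_bigr => i _; congr (_ * _).
  have [S1 u1 w1] := Hsol q1 i c1 v1; have [S2 u2 w2] := Hsol q2 i c2 v2.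
  have [||||Eu Ev] := solution_unique q1 q2 (k i) _ _ _ _ T c1 (k_gt0 i) _ S1 S2 _ _ (t - 1) _.
  - by move=> x /andP[_]; exact: E.
  - by rewrite u1 u2.
  - by rewrite w1 w2.
  - by apply/andP; split=> //; lra.
  by rewrite /forecast /sin2 /cos2 /energy Eu Ev.
have qsc n : continuous (qs n) by exact: ((qsP n).1 0%N).
(* Passing to the next iterate also adds one term to the sum; its index is [n.+1] in the inductive
   step, and it is still off because [t <= n.+1 <= X n.+1]. *)
have qsS n t : t <= n%:R -> qs n.+1 t = qs n t.
  elim: n t => [|n IH] t tn; first by rewrite !(qsP _).2 //; lra.
  have E : next (qs n.+1) n.+1 t = next (qs n) n.+1 t.
    apply: (next_eq _ _ _ _ n%:R) => //; try exact: (qsP _).2.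
    by rewrite -natr1 in tn; lra.
  rewrite [RHS]/qs -/qs -E [LHS]/qs -/qs /next /delayed_potential big_ord_recr /=.
  by rewrite wt_off ?mulr0 ?mul0r ?addr0 // (le_trans tn).
have qs_eq n m t : (n <= m)%N -> t <= n%:R -> qs m t = qs n t.
  move=> nm tn; rewrite -(subnKC nm); elim: (m - n)%N => [|d IH]; first by rewrite addn0.
  by rewrite addnS qsS // (le_trans tn) // ler_nat leq_addr.
(* The limit is read off diagonally, from an iterate whose index exceeds [|t|]. *)
pose q t := qs (Num.bound `|t|) t.
have qE n t : t <= n%:R -> q t = qs n t.
  move=> tn; have tb : t <= (Num.bound `|t|)%:R.
    by apply: ltW; rewrite (le_lt_trans (ler_norm t)) // archi_boundP.
  by rewrite /q -(qs_eq _ _ _ (leq_maxl _ n) tb) (qs_eq _ _ _ (leq_maxr _ n) tn).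
have sq : smooth q.
  by move=> n; apply: Cn_local => m; exists (qs m); [exact: (qsP m).1 | exact: qE].
have vq : vanishes q by move=> t t1; rewrite (qE 1%N) // (qsP 1%N).2.
have cq : continuous q by exact: (sq 0%N).
exists q, (fun i => (sol q i).1), (fun i => (sol q i).2); split => //.
- by move=> i; exact: Hsol.
- by move=> i; exact: Epos.
move=> T; exists (Num.bound `|T|).+1 => -[//|N] TN t tT.
have tN : t <= N%:R.
  apply: (le_trans tT); apply: (le_trans (ler_norm T)).
  by apply: (le_trans (ltW (archi_boundP (normr_ge0 T)))); rewrite ler_nat.
rewrite (qE N.+1) ?(le_trans tN) ?ler_nat //.
apply: (next_eq _ _ _ _ N%:R) => //; first exact: (qsP N).2.
  by move=> x xN; rewrite (qE N).
by lra.
Qed.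

End Construction.

(** * Square-integrable eigensolutions *)

Section Eigensolutions.
Context {R : realType}.
Implicit Types (t x : R).

(** The square of [u] is dominated by [C / (1 + t ^ 2)], whose integral over the half-line is
    [C * pi / 2]. *)
Lemma decay_L2 (u : R -> R) (C : R) : continuous u ->
  (forall t, 0 <= t -> u t ^+ 2 * (1 + t ^+ 2) <= C) -> is_L2_hl u.
Proof.
move=> cu uC; have mu_ : measurable_fun (`]0, +oo[ : set R) u.
  by apply: measurable_funTS; exact: continuous_measurable_fun.
split => //; have C0 : 0 <= C.
  by apply: le_trans (uC 0 (lexx 0)); rewrite mulr_ge0 ?sqr_ge0 // ltW // oneD_gt0.
have m1 : measurable_fun [set: R] (fun x : R => (oneDsqr x)^-1).
  by apply: continuous_measurable_fun; exact: continuous_oneDsqrV.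
have I0 x : (0 <= ((oneDsqr x)^-1)%:E)%E by rewrite lee_fin invr_ge0 ltW // oneD_gt0.
apply: (@le_lt_trans _ _ (\int[@lebesgue_measure R]_(x in `]0%R, +oo[) (C%:E * ((oneDsqr x)^-1)%:E))%E).
  apply: ge0_le_integral => //.
  - apply/measurable_EFinP; apply: measurable_funX; exact: measurableT_comp.
  - apply: measurable_funeM; apply/measurable_EFinP; exact: measurable_funTS.
  move=> x; rewrite /= in_itv /= andbT => x0; rewrite -EFinM lee_fin.
  rewrite ler_pdivlMr ?oneD_gt0 // real_normK ?num_real //; apply: uC; exact: ltW.
rewrite ge0_integralZl_EFin //; last first.
  by apply/measurable_EFinP; exact: measurable_funTS.
apply: (@le_lt_trans _ _ (C%:E * (pi / 2)%:E)%E); last by rewrite -EFinM ltry.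
rewrite lee_wpmul2l ?lee_fin // -integral0y_oneDsqr.
apply: ge0_subset_integral => //.
  by apply/measurable_EFinP; exact: measurable_funTS.
by apply: subset_itvr; rewrite bnd_simp.
Qed.

Lemma cos_neq0_bc (theta : R) : 0 <= theta <= pi -> theta <> pi / 2 -> cos theta != 0.
Proof.
move=> th n; apply/eqP => c0; apply: n; apply: cos_inj.
- by rewrite in_itv.
- by rewrite in_itv /=; have := pi_gt0 R; lra.
- by rewrite c0 cos_pihalf.
Qed.

Lemma solves_eigensolution (q u v : R -> R) (k theta C : R) :
  0 < k -> solves q k u v -> (forall x, 0 < energy u v x) ->
  u 0 = cos theta -> v 0 = sin theta / k -> 0 <= theta <= pi ->
  (forall t, 0 <= t -> energy u v t * (1 + t ^+ 2) <= C) ->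
  L2_eigensolution q (k ^+ 2) theta.
Proof.
move=> k0 S E0 u0 v0 th uC; have [du dv] := S; have kn : k != 0 by rewrite gt_eqF.
exists u, (fun x => k * v x), (fun x => k * (- k * u x + q x / k * u x)); split.
  by move=> x _; apply: der_hl.
split; first by move=> x _; apply: der_hl; exact: derMl.
split; first by move=> x _; field.
split.
  (* If [u] vanished on the half-line, so would [u'] at the interior point 1, and the energy there
     would be zero. *)
  apply: contrapT => nex; have uz x : 0 <= x -> u x = 0.
    by move=> x0; apply: contrapT => ux; apply: nex; exists x.
  have d0 : is_derive (1 : R) 1 u 0.
    apply: (der_near (fun=> 0) u 1 0 0 2); first by lra.
    by move=> t /andP[t0 _]; rewrite uz // ltW.
  have := der_unique _ _ _ _ (du 1) d0 => /eqP; rewrite mulf_eq0 (negbTE kn) /= => /eqP v1.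
  by have := E0 1; rewrite /energy uz // v1 expr0n addr0 ltxx.
split.
  apply: (decay_L2 u C) => [x|t t0]; first exact: der_cont (du x).
  apply: (le_trans _ (uC t t0)); rewrite ler_wpM2r ?(ltW (oneD_gt0 _)) //.
  by rewrite lerDl sqr_ge0.
rewrite u0 v0; split=> [->|n]; first exact: cos_pihalf.
have c0 := cos_neq0_bc theta th n; split; first exact/eqP.
by rewrite /tan; field; rewrite c0 kn.
Qed.

(* [a] selects the eigenvalues to be created, and [Y i] is a lower bound, at
   our disposal, for the point where the [i]-th term of the potential starts. *)
Lemma embedded_eigenvalues (lambda theta Y : nat -> R) (a : nat -> bool) :
  injective lambda -> (forall j, 0 < lambda j) -> (forall j, 0 <= theta j <= pi) ->
  exists q : R -> R,
    [/\ smooth_hl q, forall t, t <= 1 -> q t = 0,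
        forall j, a j -> L2_eigensolution q (lambda j) (theta j) &
        forall t, 0 < t -> exists N, `|q t| <=
          \sum_(i < N) (a i && (Y i < t))%:R * (Num.sqrt (lambda i) * (16 / t))].
Proof.
move=> inj_l l0 th; pose k i := Num.sqrt (lambda i).
have k0 i : 0 < k i by rewrite sqrtr_gt0.
have k2 i : k i ^+ 2 = lambda i by rewrite sqr_sqrtr // ltW.
have kinj : injective k by move=> i j E; apply: inj_l; rewrite -!k2 E.
pose X := threshold k Y.
have X1 i : 1 <= X i.
  by apply: (le_trans _ (threshold_ge k Y k0 i)); have [] := threshold_rootP k Y k0 i.
have Xi i : i%:R <= X i.
  by apply: (le_trans _ (threshold_ge k Y k0 i)); have [] := threshold_rootP k Y k0 i.
have XY i : Y i <= X i.
  by apply: (le_trans _ (threshold_ge k Y k0 i)); have [] := threshold_rootP k Y k0 i.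
(* The data [u = cos theta], [u' = sin theta] also cover [theta = pi / 2], and they never vanish
   together. *)
have dat i : 0 < cos (theta i) ^+ 2 + (sin (theta i) / k i) ^+ 2.
  have c0 := sqr_ge0 (cos (theta i)); have s0 := sqr_ge0 (sin (theta i) / k i).
  rewrite lt0r addr_ge0 // andbT paddr_eq0 // !sqrf_eq0 mulf_eq0 invr_eq0.
  rewrite (gt_eqF (k0 i)) orbF; apply/negP => /andP[/eqP cz /eqP sz].
  by have := cos2Dsin2 (theta i); rewrite cz sz !expr0n addr0 => /eqP; rewrite eq_sym oner_eq0.
have [q [u [v [sq vq S E0 qE]]]] := delayed_fixpoint k X a _ _ k0 X1 Xi dat.
have Sol i : solves q (k i) (u i) (v i) by case: (S i).
exists q; split => //; first exact: smooth_smooth_hl.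
- move=> j aj; have [_ u0 v0] := S j.
  have [C HC] := decay k X a kinj k0 X1 (threshold_sum_k k Y k0) (threshold_sum_osc k Y k0)
    q u v Sol E0 qE j aj.
  by rewrite -k2; exact: (solves_eigensolution q (u j) (v j) (k j) (theta j) C).
move=> t t0; have [N /(_ N (leqnn N) t (lexx t)) ->] := qE t; exists N.
have ph i := solves_phase q (k i) (u i) (v i) (k0 i) (Sol i) (E0 i).
apply: (le_trans (delayed_potential_le k X a k0 X1 q _ _ N t ph t0)).
apply: ler_sum => i _; have [w0 w1] := wt_bound X a X1 i t t0.
have kt : 0 <= k i * (16 / t) by rewrite mulr_ge0 ?divr_ge0 // ltW.
rewrite -/(k i); case ai : (a i) => /=; last by rewrite /wt ai mulr0 !mul0r.
rewrite /switched in w1; have [Yt|tY] := ltP (Y i) t; last first.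
  by rewrite wt_off // ?(le_trans tY) // mulr0 !mul0r.
rewrite mul1r; have -> : k i * (16 / t) = k i * (8 / t) * 2 by ring.
rewrite ler_wpM2r // ler_wpM2l ?(ltW (k0 i)) // (le_trans w1) //.
by rewrite ler_piMl ?divr_ge0 ?(ltW t0) //; case: (_ < _).
Qed.

End Eigensolutions.

(** * The finite and the countable case *)

Theorem theorem1p4 (R : realType) :
  (forall (n : nat) (lambda theta : 'I_n -> R),
     injective lambda ->
     (forall j, 0 < lambda j) ->
     (forall j, 0 <= theta j <= pi) ->
     exists q : R -> R,
       smooth_hl q /\
       (forall j, L2_eigensolution q (lambda j) (theta j)) /\
       (exists M : R, forall x : R, 0 <= x -> `|q x| <= M / (`|x| + 1)))
  /\
  (forall lambda theta : nat -> R,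
     injective lambda ->
     (forall j, 0 < lambda j) ->
     (forall j, 0 <= theta j <= pi) ->
     forall C : R -> R,
       (forall x : R, 0 < x -> 0 < C x) ->
       C x @[x --> +oo] --> +oo ->
       exists q : R -> R,
         smooth_hl q /\
         (forall j, L2_eigensolution q (lambda j) (theta j)) /\
         (forall x : R, 0 < x -> `|q x| <= C x / (`|x| + 1))).
Proof.
split=> [n lambda theta linj l0 th|lambda theta linj l0 th C C0 Coo].
  (* The finite family is completed to an injective sequence by the values [S + i], which exceed
     every [lambda j]. The selector [i < n] gives the added indices no term in the potential. *)
  pose ext (f : 'I_n -> R) (g : nat -> R) i := if insub i is Some o then f o else g i.
  have extE f g (j : 'I_n) : ext f g j = f j by rewrite /ext valK.
  pose S := 1 + \sum_j lambda j.
  have S1 : 1 <= S by rewrite lerDl sumr_ge0 // => j _; exact: ltW.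
  have lS j : lambda j < S.
    by rewrite /S (bigD1 j) //= addrCA ltrDl ltr_pwDl // sumr_ge0 // => i _; exact: ltW.
  have [||j|q [sq q0 eig qle]] := embedded_eigenvalues (ext lambda (fun i => S + i%:R))
    (ext theta (fun=> 0)) (fun=> 0) (fun i => (i < n)%N).
  - have Sneq i o : S + i%:R = lambda o -> False.
      by move=> E; have := lS o; rewrite -E ltNge lerDl ler0n.
    move=> i j; rewrite /ext; case: insubP => [i' _ <-|_]; case: insubP => [j' _ <-|_].
    + by move/linj => ->.
    + by move/esym/Sneq.
    + by move/Sneq.
    by move/addrI/eqP; rewrite eqr_nat => /eqP.
  - move=> i; rewrite /ext; case: insubP => // _; rewrite ltr_wpDr //.
    exact: lt_le_trans S1.
  - by rewrite /ext; case: insubP => // _; rewrite lexx pi_ge0.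
  exists q; split => //; split => [j|].
    by have := eig j (ltn_ord j); rewrite !extE.
  pose l i := ext lambda (fun i => S + i%:R) i.
  pose W := \sum_(i < n) Num.sqrt (l i).
  have W0 : 0 <= W by apply: sumr_ge0 => i _; exact: sqrtr_ge0.
  (* For [x > 1] the potential is at most [16 * W / x], and [1 / x <= 2 / (x + 1)]. *)
  exists (32 * W) => x x0; rewrite (ger0_norm x0); have [x1|x1] := leP x 1.
    by rewrite q0 // normr0 divr_ge0 ?mulr_ge0 // addr_ge0.
  have xp : 0 < x by lra.
  have [N /le_trans] := qle x xp; apply.
  apply: (@le_trans _ _ (W * (16 / x))).
    apply: (@le_trans _ _ (\sum_(i < N) (i < n)%N%:R * Num.sqrt (l i) * (16 / x))).
      by apply: ler_sum => i _ /=; rewrite xp andbT mulrA.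
    rewrite -mulr_suml ler_wpM2r ?divr_ge0 //.
    by apply: (sum_trunc (fun i => Num.sqrt (l i))) => i; exact: sqrtr_ge0.
  rewrite [32 * W]mulrC -mulrA ler_wpM2l // ler_pdivrMr // mulrAC ler_pdivlMr; last by lra.
  by lra.
(* Past [Y i] the term [16 * sqrt (lambda i) / x <= 32 * sqrt (lambda i) / (x + 1)] is at most
   [C x / (x + 1) / 2] divided by [2 ^ i]; these bounds sum to at most [C x / (x + 1)]. *)
have /choice [Y HY] i : exists Y : R, forall x, Y < x -> 64 * Num.sqrt (lambda i) * 2 ^+ i <= C x.
  have : \forall x \near +oo, 64 * Num.sqrt (lambda i) * 2 ^+ i <= C x.
    by move/cvgryPge : Coo; apply.
  by move=> [Y [_ HY]]; exists Y.
have [q [sq q0 eig qle]] := embedded_eigenvalues lambda theta Y xpredT linj l0 th.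
exists q; split => //; split => [j|x x0]; first exact: eig.
rewrite (gtr0_norm x0); have [x1|x1] := leP x 1.
  by rewrite q0 // normr0 divr_ge0 ?ltW ?C0 // ltr_wpDr.
have [N /le_trans] := qle x x0; apply.
have D0 : 0 <= C x / (x + 1) / 2 by rewrite !divr_ge0 ?ltW ?C0 // ltr_wpDr.
apply: (@le_trans _ _ (\sum_(i < N) (2 ^+ i)^-1 * (C x / (x + 1) / 2))); last first.
  by rewrite -mulr_suml; have := ler_wpM2r D0 (sum_half N); lra.
apply: ler_sum => i _ /=; have [Yx|_] := ltP (Y i) x; last first.
  by rewrite mul0r mulr_ge0 // invr_ge0 exprn_ge0.
rewrite mul1r ler_pdivlMl ?exprn_gt0 //.
apply: (@le_trans _ _ (64 * Num.sqrt (lambda i) * 2 ^+ i * ((x + 1)^-1 / 2))).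
  have -> : 2 ^+ i * (Num.sqrt (lambda i) * (16 / x)) =
    Num.sqrt (lambda i) * 2 ^+ i * (16 / x) by ring.
  have -> : 64 * Num.sqrt (lambda i) * 2 ^+ i * ((x + 1)^-1 / 2) =
    Num.sqrt (lambda i) * 2 ^+ i * (32 / (x + 1)) by field; lra.
  rewrite ler_wpM2l ?mulr_ge0 ?sqrtr_ge0 ?exprn_ge0 // ler_pdivrMr // mulrAC ler_pdivlMr; last by lra.
  by lra.
rewrite -[leRHS]mulrA ler_wpM2r ?HY // divr_ge0 // invr_ge0; lra.
Qed.
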